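(* Let $R$ be a noetherian normal integral domain with fraction field $K$ and let $A$ be an $R$-algebra that is finitely generated and flat as an $R$-module and such that $A^K=K\otimes_R A$ is a split $K$-algebra. Let $\mathrm{At}(A)$ be the set of irreducible components of the closed subset $\mathrm{BlEx}(A)\subseteq\operatorname{Spec}(R)$, and for $Z\in\mathrm{At}(A)$ let $\mathrm{Bl}_A(Z)$ denote the value of $\mathrm{Bl}_A$ at the generic point of $Z$. Then for every $\mathfrak{p}\in\operatorname{Spec}(R)$ one has $$\mathrm{Bl}_A(\mathfrak{p})=\bigwedge_{\substack{Z\in\mathrm{At}(A)\\ \mathfrak{p}\in Z}}\mathrm{Bl}_A(Z),$$ where $\wedge$ is the meet of partitions.
   Context: Block idempotents of a ring are its centrally-primitive idempotents (primitive idempotents of the center). Let $\{c_i\}_{i\in I}$ be the block idempotents of $A^K$. For $\mathfrak{p}\in\operatorname{Spec}(R)$ the canonical map $A_{\mathfrak{p}}\to A^K$ is injective, and each block idempotent of $A_{\mathfrak{p}}$ is, in $A^K$, a sum $\sum_{i\in I'}c_i$ for a unique $I'\subseteq I$; the subsets $I'$ so obtained form a partition $\mathrm{Bl}_A(\mathfrak{p})$ of $I$. Partitions are ordered by $\mathscr{P}'\leq\mathscr{P}$ iff each member of $\mathscr{P}'$ is a union of members of $\mathscr{P}$ (i.e. $\mathscr{P}'$ is coarser). The meet of a family of partitions is the finest partition of $I$ that is coarser than or equal to all of them (obtained by repeatedly joining members with non-empty intersection); the empty meet is the partition into singletons. $\mathrm{BlEx}(A)=\{\mathfrak{p}\in\operatorname{Spec}(R)\mid\mathrm{Bl}_A(\mathfrak{p})<\mathrm{Bl}_A((0))\}$,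 where $\mathrm{Bl}_A((0))=\{\{i\}\mid i\in I\}$; this set is closed in $\operatorname{Spec}(R)$. A finite-dimensional algebra over a field is split if all of its simple modules remain simple under every extension of the base field. *)

(* Defs.v *)
From HB Require Import structures.
From Stdlib Require Import Relation_Operators.
From mathcomp Require Import all_boot all_algebra.
From mathcomp Require Import generic_quotient.
From mathcomp Require Import boolp classical_sets functions cardinality fsbigop.
From mathcomp Require Import filter topology_structure.

Set Implicit Arguments.
Unset Strict Implicit.
Unset Printing Implicit Defensive.

Import GRing.Theory.

Local Open Scope quotient_scope.
Local Open Scope classical_set_scope.
Local Open Scope ring_scope.

Definition restr (R S : pzRingType) (f : {rmorphism R -> S}) (V : lmodType S) :
  Type := V.

Section Restr.
Variables (R S : pzRingType) (f : {rmorphism R -> S}) (V : lmodType S).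

HB.instance Definition _ := GRing.Zmodule.on (restr f V).

Definition restr_scale (r : R) (v : restr f V) : restr f V := f r *: (v : V).

Fact restr_scaleA a b v : restr_scale a (restr_scale b v) = restr_scale (a * b) v.
Proof. by rewrite /restr_scale rmorphM scalerA. Qed.
Fact restr_scale1 : left_id 1 restr_scale.
Proof. by move=> v; rewrite /restr_scale rmorph1 scale1r. Qed.
Fact restr_scaleDr : right_distributive restr_scale +%R.
Proof. by move=> a u v; rewrite /restr_scale scalerDr. Qed.
Fact restr_scaleDl v : {morph restr_scale^~ v : a b / a + b}.
Proof. by move=> a b; rewrite /restr_scale rmorphD scalerDl. Qed.

HB.instance Definition _ := GRing.Zmodule_isLmodule.Build R (restr f V)
  restr_scaleA restr_scale1 restr_scaleDr restr_scaleDl.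

Lemma restr_scaleE (r : R) (v : restr f V) : r *: v = f r *: (v : V) :> V.
Proof. by []. Qed.

End Restr.

Section Tensor.
Variables (R : comPzRingType) (M N : lmodType R).

(* A sequence stands for the formal sum of the pure tensors of its entries;
   the tensor product is the quotient of the monoid of formal sums by the
   congruence generated by bilinearity. *)
Inductive tens_eq : seq (M * N) -> seq (M * N) -> Prop :=
| tens_refl s : tens_eq s s
| tens_sym s t : tens_eq s t -> tens_eq t s
| tens_trans s t u : tens_eq s t -> tens_eq t u -> tens_eq s u
| tens_cat s s' t t' : tens_eq s s' -> tens_eq t t' -> tens_eq (s ++ t) (s' ++ t')
| tens_catC s t : tens_eq (s ++ t) (t ++ s)
| tens_zero n : tens_eq [:: (0, n)] [::]
| tens_addl m m' n : tens_eq [:: (m + m', n)] [:: (m, n); (m', n)]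
| tens_addr m n n' : tens_eq [:: (m, n + n')] [:: (m, n); (m, n')]
| tens_scale r m n : tens_eq [:: (r *: m, n)] [:: (m, r *: n)].

Definition tens_eqb (s t : seq (M * N)) : bool := `[< tens_eq s t >].

Fact tens_eqb_refl : reflexive tens_eqb.
Proof. by move=> s; apply/asboolP; exact: tens_refl. Qed.
Fact tens_eqb_sym : symmetric tens_eqb.
Proof. by move=> s t; apply/asboolP/asboolP; exact: tens_sym. Qed.
Fact tens_eqb_trans : transitive tens_eqb.
Proof. by move=> t s u /asboolP st /asboolP tu; apply/asboolP; exact: tens_trans tu. Qed.

Canonical tens_equiv := EquivRel tens_eqb tens_eqb_refl tens_eqb_sym tens_eqb_trans.

Definition tensor := {eq_quot tens_equiv}.
HB.instance Definition _ := Choice.on tensor.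
HB.instance Definition _ := EqQuotient.on tensor.

Definition tpi (s : seq (M * N)) : tensor := \pi_tensor s.

Lemma tpiP s t : tpi s = tpi t <-> tens_eq s t.
Proof.
split; last by move=> st; apply/eqmodP/asboolP.
by move/eqmodP/asboolP.
Qed.

Lemma tpi_repr (x : tensor) : tpi (repr x) = x.
Proof. exact: reprK. Qed.

Lemma repr_tpi s : tens_eq (repr (tpi s)) s.
Proof. by apply/tpiP; rewrite tpi_repr. Qed.

Definition topp_seq (s : seq (M * N)) := [seq (- x.1, x.2) | x <- s].
Definition tscale_seq r (s : seq (M * N)) := [seq (r *: x.1, x.2) | x <- s].

Lemma tens_cat1 s s' t : tens_eq s s' -> tens_eq (s ++ t) (s' ++ t).
Proof. by move=> ?; apply: tens_cat => //; exact: tens_refl. Qed.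
Lemma tens_cat2 s t t' : tens_eq t t' -> tens_eq (s ++ t) (s ++ t').
Proof. by move=> ?; apply: tens_cat => //; exact: tens_refl. Qed.

Lemma tens_scale_seq r s t : tens_eq s t -> tens_eq (tscale_seq r s) (tscale_seq r t).
Proof.
rewrite /tscale_seq; elim=> {s t} /=.
- by move=> s; exact: tens_refl.
- by move=> s t _; exact: tens_sym.
- by move=> s t u _ st _; exact: tens_trans.
- by move=> s s' t t' _ ss _ tt; rewrite !map_cat; exact: tens_cat.
- by move=> s t; rewrite !map_cat; exact: tens_catC.
- by move=> n; rewrite scaler0; exact: tens_zero.
- by move=> m m' n; rewrite scalerDr; exact: tens_addl.
- by move=> m n n'; exact: tens_addr.
- by move=> a m n; rewrite scalerA mulrC -scalerA; exact: tens_scale.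
Qed.

Lemma topp_seqE s : topp_seq s = tscale_seq (- 1) s.
Proof. by apply: eq_map => x; rewrite scaleN1r. Qed.

Definition tzero : tensor := tpi [::].
Definition tadd (x y : tensor) : tensor := tpi (repr x ++ repr y).
Definition topp (x : tensor) : tensor := tpi (topp_seq (repr x)).
Definition tscale r (x : tensor) : tensor := tpi (tscale_seq r (repr x)).

Lemma tadd_pi s t : tadd (tpi s) (tpi t) = tpi (s ++ t).
Proof. by apply/tpiP; apply: tens_cat; exact: repr_tpi. Qed.
Lemma tscale_pi r s : tscale r (tpi s) = tpi (tscale_seq r s).
Proof. by apply/tpiP; apply: tens_scale_seq; exact: repr_tpi. Qed.
Lemma topp_pi s : topp (tpi s) = tpi (topp_seq s).
Proof. by rewrite /topp !topp_seqE -/(tscale _ _) tscale_pi. Qed.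

Lemma tpi_surj (P : tensor -> Prop) : (forall s, P (tpi s)) -> forall x, P x.
Proof. by move=> Ps x; rewrite -(tpi_repr x). Qed.

Fact taddA : associative tadd.
Proof.
elim/tpi_surj=> s; elim/tpi_surj=> t; elim/tpi_surj=> u.
by rewrite !tadd_pi catA.
Qed.
Fact taddC : commutative tadd.
Proof.
elim/tpi_surj=> s; elim/tpi_surj=> t; rewrite !tadd_pi.
by apply/tpiP; exact: tens_catC.
Qed.
Fact tadd0 : left_id tzero tadd.
Proof. by elim/tpi_surj=> s; rewrite tadd_pi. Qed.
Fact taddN : left_inverse tzero topp tadd.
Proof.
elim/tpi_surj=> s; rewrite topp_pi tadd_pi; apply/tpiP.
elim: s => [|[m n] s IHs] /=; first exact: tens_refl.
rewrite -cat1s -(cat1s (m, n)).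
apply: (tens_trans (t := [:: (- m, n)] ++ [:: (m, n)] ++ topp_seq s ++ s)).
  apply: tens_cat2; rewrite !catA; apply: tens_cat1; exact: tens_catC.
rewrite catA -[X in tens_eq _ X]cats0; apply: tens_cat => //.
apply: tens_trans (tens_zero n); apply: tens_sym.
by rewrite -{1}(addNr m); exact: tens_addl.
Qed.

HB.instance Definition _ := GRing.isZmodule.Build tensor taddA taddC tadd0 taddN.

Lemma tpi_cat s t : tpi (s ++ t) = tpi s + tpi t.
Proof. exact/esym/tadd_pi. Qed.
Lemma tpi_cons x s : tpi (x :: s) = tpi [:: x] + tpi s.
Proof. by rewrite -tpi_cat. Qed.

Fact tscaleA a b x : tscale a (tscale b x) = tscale (a * b) x.
Proof.
elim/tpi_surj: x => s; rewrite !tscale_pi /tscale_seq -map_comp; congr tpi.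
by apply: eq_map => x /=; rewrite scalerA.
Qed.
Fact tscale1 : left_id 1 tscale.
Proof.
elim/tpi_surj=> s; rewrite tscale_pi /tscale_seq; congr tpi.
by rewrite -[RHS]map_id; apply: eq_map => -[m n] /=; rewrite scale1r.
Qed.
Fact tscaleDr : right_distributive tscale +%R.
Proof.
move=> a; elim/tpi_surj=> s; elim/tpi_surj=> t.
by rewrite -tpi_cat !tscale_pi -tpi_cat /tscale_seq map_cat.
Qed.
Fact tscaleDl x : {morph tscale^~ x : a b / a + b}.
Proof.
move=> a b; elim/tpi_surj: x => s; rewrite !tscale_pi.
elim: s => [|[m n] s IHs] /=; first by rewrite -tpi_cat.
rewrite ![tpi (_ :: tscale_seq _ _)]tpi_cons IHs addrACA; congr (_ + _).
by rewrite scalerDl -tpi_cat; apply/tpiP; exact: tens_addl.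
Qed.

HB.instance Definition _ := GRing.Zmodule_isLmodule.Build R tensor
  tscaleA tscale1 tscaleDr tscaleDl.

Definition pure (m : M) (n : N) : tensor := tpi [:: (m, n)].

Lemma pureDl m m' n : pure (m + m') n = pure m n + pure m' n.
Proof. by rewrite -tpi_cat; apply/tpiP; exact: tens_addl. Qed.
Lemma pureDr m n n' : pure m (n + n') = pure m n + pure m n'.
Proof. by rewrite -tpi_cat; apply/tpiP; exact: tens_addr. Qed.
Lemma pureZ r m n : pure (r *: m) n = pure m (r *: n).
Proof. by apply/tpiP; exact: tens_scale. Qed.
Lemma scale_pure r m n : r *: pure m n = pure (r *: m) n.
Proof. exact: tscale_pi. Qed.

Lemma tensor_ind (P : tensor -> Prop) :
  P 0 -> (forall m n, P (pure m n)) -> (forall x y, P x -> P y -> P (x + y)) ->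
  forall x, P x.
Proof.
move=> P0 Pp PD; elim/tpi_surj; elim=> [|[m n] s IHs]; first exact: P0.
by rewrite -cat1s tpi_cat; apply: PD => //; exact: Pp.
Qed.

(* The additive map induced by [f] when [f] is balanced bilinear; the value is
   meaningless otherwise. *)
Definition tlift (P : zmodType) (f : M -> N -> P) (x : tensor) : P :=
  \sum_(p <- repr x) f p.1 p.2.

Definition balanced (P : zmodType) (f : M -> N -> P) : Prop :=
  [/\ forall m m' n, f (m + m') n = f m n + f m' n,
      forall m n n', f m (n + n') = f m n + f m n' &
      forall r m n, f (r *: m) n = f m (r *: n)].

Section Lift.
Variables (P : zmodType) (f : M -> N -> P).
Hypothesis bf : balanced f.

Lemma tlift_pi s : tlift f (tpi s) = \sum_(p <- s) f p.1 p.2.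
Proof.
have [fDl fDr fZ] := bf.
suff key u v : tens_eq u v -> \sum_(p <- u) f p.1 p.2 = \sum_(p <- v) f p.1 p.2.
  exact/key/repr_tpi.
elim=> {s u v} //=.
- by move=> s t u _ -> _ ->.
- by move=> s s' t t' _ ss _ tt; rewrite !big_cat /= ss tt.
- by move=> s t; rewrite !big_cat /= addrC.
- by move=> n; rewrite big_seq1 big_nil /=; apply: (addrI (f 0 n));
    rewrite -fDl !addr0.
- by move=> m m' n; rewrite !big_cons !big_nil /= !addr0 fDl.
- by move=> m n n'; rewrite !big_cons !big_nil /= !addr0 fDr.
- by move=> r m n; rewrite !big_cons !big_nil /= !addr0 fZ.
Qed.

Lemma tlift_pure m n : tlift f (pure m n) = f m n.
Proof. by rewrite tlift_pi big_seq1. Qed.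
Lemma tliftD : {morph tlift f : x y / x + y}.
Proof.
elim/tpi_surj=> s; elim/tpi_surj=> t.
by rewrite -tpi_cat !tlift_pi big_cat.
Qed.
Lemma tlift0 : tlift f 0 = 0.
Proof. by rewrite (tlift_pi [::]) big_nil. Qed.

End Lift.

Lemma tensor_eq (P : zmodType) (g h : tensor -> P) :
  {morph g : x y / x + y} -> {morph h : x y / x + y} ->
  (forall m n, g (pure m n) = h (pure m n)) -> g =1 h.
Proof.
move=> gD hD gh; elim/tensor_ind => //; last by move=> x y gx gy; rewrite gD hD gx gy.
have k0 (k : tensor -> P) : {morph k : x y / x + y} -> k 0 = 0.
  by move=> kD; apply: (addrI (k 0)); rewrite -kD !addr0.
by rewrite !k0.
Qed.

End Tensor.

Arguments pure {R M N}.

Definition tensor_mapl (R : comPzRingType) (N P M : lmodType R)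
    (f : {linear N -> P}) : tensor N M -> tensor P M :=
  tlift (fun n m => pure (f n) m).

Definition finitely_generated (R : pzRingType) (M : lmodType R) : Prop :=
  exists (n : nat) (g : 'I_n -> M),
    forall x, exists c : 'I_n -> R, x = \sum_i c i *: g i.

Definition flat (R : comPzRingType) (M : lmodType R) : Prop :=
  forall (N P : lmodType R) (f : {linear N -> P}),
    injective f -> injective (tensor_mapl (M := M) f).

Definition submodule (R : pzRingType) (M : lmodType R) (U : set M) : Prop :=
  [/\ U 0, forall x y, U x -> U y -> U (x + y) & forall a x, U x -> U (a *: x)].

Definition simple_module (R : pzRingType) (M : lmodType R) : Prop :=
  (exists x : M, x <> 0) /\
  forall U : set M, submodule U -> U = [set 0] \/ U = setT.

(* [algType R] excludes the zero ring, which base change can produce; hence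
   algebras are rings with a central structure morphism. *)
Record algebra (R : comPzRingType) := Algebra {
  alg_ring :> pzRingType;
  alg_map : {rmorphism R -> alg_ring};
  alg_mapC : forall r x, alg_map r * x = x * alg_map r }.
Arguments alg_map {R} _.

Definition alg_mod (R : comPzRingType) (A : algebra R) : lmodType R :=
  restr (alg_map A) (A^o : lmodType A).

Section BaseChange.
Variables (R B : comPzRingType) (f : {rmorphism R -> B}).

Local Notation Bm := (restr f (B^o : lmodType B)).

Definition bc_mod (A : algebra R) (V : lmodType A) : Type :=
  tensor Bm (restr (alg_map A) V).
HB.instance Definition _ (A : algebra R) (V : lmodType A) :=
  GRing.Zmodule.on (bc_mod V).

Definition bc_ring (A : algebra R) : Type := bc_mod (A^o : lmodType A).
HB.instance Definition _ (A : algebra R) := GRing.Zmodule.on (bc_ring A).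

Definition bc_pure (A : algebra R) (V : lmodType A) (b : B) (v : V) : bc_mod V :=
  pure (b : Bm) (v : restr (alg_map A) V).

Section Act.
Variables (A : algebra R) (V : lmodType A).
Implicit Types (b : B) (a : A) (v : V) (x y : bc_ring A) (w : bc_mod V).

Lemma bc_pureDl b b' v : bc_pure (b + b') v = bc_pure b v + bc_pure b' v.
Proof. exact: pureDl. Qed.
Lemma bc_pureDr b v v' : bc_pure b (v + v') = bc_pure b v + bc_pure b v'.
Proof. exact: pureDr. Qed.
Lemma bc_pureZ r b v : bc_pure (f r * b) v = bc_pure b (alg_map A r *: v).
Proof. exact: pureZ. Qed.

Lemma bc_eq (P : zmodType) (g h : bc_mod V -> P) :
  {morph g : x y / x + y} -> {morph h : x y / x + y} ->
  (forall b v, g (bc_pure b v) = h (bc_pure b v)) -> g =1 h.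
Proof. exact: tensor_eq. Qed.

(* The action is (b (x) a) (b' (x) v) = b b' (x) a v. *)
Definition bc_act1 b a : bc_mod V -> bc_mod V :=
  tlift (fun (b' : Bm) (v : restr (alg_map A) V) =>
    bc_pure (b * (b' : B)) (a *: (v : V))).

Definition bc_act x w : bc_mod V :=
  tlift (fun (b : Bm) (a : restr (alg_map A) A^o) => bc_act1 b a w) x.

Lemma bc_act1_balanced b a : balanced (fun (b' : Bm) (v : restr (alg_map A) V) =>
  bc_pure (b * (b' : B)) (a *: (v : V))).
Proof.
split=> [m m' n|m n n'|r m n].
- by rewrite mulrDr bc_pureDl.
- by rewrite scalerDr bc_pureDr.
- rewrite !restr_scaleE [in LHS]/GRing.scale /= mulrCA bc_pureZ.
  by rewrite !scalerA alg_mapC.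
Qed.

Lemma bc_act1_pure b a b' v :
  bc_act1 b a (bc_pure b' v) = bc_pure (b * b') (a *: v).
Proof. by rewrite /bc_act1 tlift_pure //; exact: bc_act1_balanced. Qed.

Lemma bc_act1D b a : {morph bc_act1 b a : w w' / w + w'}.
Proof. by apply: tliftD; exact: bc_act1_balanced. Qed.

Lemma bc_act_balanced w :
  balanced (fun (b : Bm) (a : restr (alg_map A) A^o) => bc_act1 b a w).
Proof.
split=> [m m' n|m n n'|r m n]; move: w; apply: bc_eq => [||b v];
  do ?[exact: bc_act1D | by move=> x y; rewrite !bc_act1D addrACA].
- by rewrite !bc_act1_pure mulrDl bc_pureDl.
- by rewrite !bc_act1_pure scalerDl bc_pureDr.
- rewrite !bc_act1_pure !restr_scaleE [in LHS]/GRing.scale /= -mulrA bc_pureZ.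
  by rewrite scalerA.
Qed.

Lemma bc_act_pure1 b a w : bc_act (bc_pure b (a : A^o)) w = bc_act1 b a w.
Proof. by rewrite /bc_act tlift_pure //; exact: bc_act_balanced. Qed.

Lemma bc_act_pure b a b' v :
  bc_act (bc_pure b (a : A^o)) (bc_pure b' v) = bc_pure (b * b') (a *: v).
Proof. by rewrite bc_act_pure1 bc_act1_pure. Qed.

Lemma bc_actDl w : {morph bc_act^~ w : x y / x + y}.
Proof. by move=> x y; rewrite /bc_act tliftD //; exact: bc_act_balanced. Qed.

Lemma bc_actDr x : {morph bc_act x : w w' / w + w'}.
Proof.
move=> w w'; move: x; apply: tensor_eq => [x y|x y|b a].
- exact: bc_actDl.
- by rewrite !bc_actDl addrACA.
- by rewrite !bc_act_pure1 bc_act1D.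
Qed.

End Act.

Section Ring.
Variable A : algebra R.

Definition bc_mul (x y : bc_ring A) : bc_ring A := bc_act x (y : bc_mod A^o).
Definition bc_one : bc_ring A := bc_pure 1 (1 : A^o).

Lemma bc_actA (V : lmodType A) (x y : bc_ring A) (w : bc_mod V) :
  bc_act x (bc_act y w) = bc_act (bc_mul x y) w.
Proof.
move: x; apply: tensor_eq => [x x'|x x'|b a]; rewrite ?bc_actDl //.
  by rewrite /bc_mul bc_actDl bc_actDl.
move: y; apply: tensor_eq => [y y'|y y'|b' a']; rewrite ?bc_actDl ?bc_actDr //.
  by rewrite /bc_mul bc_actDr bc_actDl.
move: w; apply: tensor_eq => [w w'|w w'|b'' v]; rewrite ?bc_actDr //.
by rewrite /bc_mul !bc_act_pure mulrA scalerA.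
Qed.

Lemma bc_act_one (V : lmodType A) (w : bc_mod V) : bc_act bc_one w = w.
Proof.
move: w; apply: tensor_eq => [w w'|w w'|b'' v]; rewrite ?bc_actDr //.
by rewrite bc_act_pure mul1r scale1r.
Qed.

Fact bc_mulA : associative bc_mul.
Proof. by move=> x y z; exact: bc_actA. Qed.
Fact bc_mul1 : left_id bc_one bc_mul.
Proof. by move=> x; exact: bc_act_one. Qed.
Fact bc_mulr1 : right_id bc_one bc_mul.
Proof.
apply: tensor_eq => [w w'|w w'|b v] //; first by rewrite /bc_mul bc_actDl.
by rewrite /bc_mul bc_act_pure mulr1 /GRing.scale /= mulr1.
Qed.
Fact bc_mulDl : left_distributive bc_mul +%R.
Proof. by move=> x y z; exact: bc_actDl. Qed.
Fact bc_mulDr : right_distributive bc_mul +%R.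
Proof. by move=> x y z; exact: bc_actDr. Qed.

HB.instance Definition _ := GRing.Zmodule_isPzRing.Build (bc_ring A)
  bc_mulA bc_mul1 bc_mulr1 bc_mulDl bc_mulDr.

Definition bc_map (b : B) : bc_ring A := bc_pure b (1 : A^o).

Fact bc_map_zmod : zmod_morphism bc_map.
Proof.
move=> b b'; apply: (addIr (bc_map b')).
by rewrite addrNK /bc_map -bc_pureDl addrNK.
Qed.
Fact bc_map_monoid : monoid_morphism bc_map.
Proof.
split=> // b b'; rewrite [RHS]bc_act_pure.
by rewrite /bc_map [in RHS]/GRing.scale /= mulr1.
Qed.
HB.instance Definition _ := GRing.isZmodMorphism.Build B (bc_ring A) bc_map bc_map_zmod.
HB.instance Definition _ :=
  GRing.isMonoidMorphism.Build B (bc_ring A) bc_map bc_map_monoid.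

Fact bc_mapC b (x : bc_ring A) : bc_map b * x = x * bc_map b.
Proof.
move: x; apply: tensor_eq => [w w'|w w'|b' v]; first exact: mulrDr.
  exact: mulrDl.
rewrite [LHS]bc_act_pure [RHS]bc_act_pure mulrC.
by rewrite /GRing.scale /= mulr1 mul1r.
Qed.

Definition base_change : algebra B := Algebra bc_mapC.

HB.instance Definition _ (V : lmodType A) :=
  GRing.Zmodule_isLmodule.Build (bc_ring A) (bc_mod V)
    (@bc_actA V) (@bc_act_one V) (@bc_actDr A V) (@bc_actDl A V).

End Ring.

Definition base_change_mod (A : algebra R) (V : lmodType A) :
  lmodType (base_change A) := bc_mod V.

End BaseChange.

Definition split_algebra (K : fieldType) (A : algebra K) : Prop :=
  forall S : lmodType A, simple_module S ->
    forall (L : fieldType) (g : {rmorphism K -> L}),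
      simple_module (base_change_mod g S).

Section Blocks.
Variable A : pzRingType.

Definition central_idempotent (e : A) : Prop :=
  e * e = e /\ forall x, e * x = x * e.

Definition block_idempotent : set A := [set e |
  [/\ central_idempotent e, e <> 0 &
      forall e1 e2, central_idempotent e1 -> central_idempotent e2 ->
        e1 * e2 = 0 -> e = e1 + e2 -> e1 = 0 \/ e2 = 0]].

End Blocks.

Definition is_ideal (R : comPzRingType) (J : set R) : Prop :=
  [/\ J 0, forall x y, J x -> J y -> J (x + y) & forall a x, J x -> J (a * x)].

Definition noetherian (R : comPzRingType) : Prop :=
  forall J : set R, is_ideal J ->
    exists (n : nat) (g : 'I_n -> R),
      J = [set x | exists c : 'I_n -> R, x = \sum_i c i * g i].

Definition to_frac (R : idomainType) : {rmorphism R -> {fraction R}} :=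
  @FracField.tofrac R.

Definition normal_domain (R : idomainType) : Prop :=
  forall x : {fraction R}, integralOver (to_frac R) x -> exists r, x = to_frac R r.

Definition prime_ideal (R : comPzRingType) (p : set R) : Prop :=
  [/\ is_ideal p, ~ p 1 & forall x y, p (x * y) -> p x \/ p y].

Record spec (R : comPzRingType) := Spec {
  spec_set : set R;
  spec_prime : prime_ideal spec_set }.

Section Zariski.
Variable R : comPzRingType.

HB.instance Definition _ := gen_eqMixin (spec R).
HB.instance Definition _ := gen_choiceMixin (spec R).

(* V(J); [J] need not be an ideal. *)
Definition zeros (J : set R) : set (spec R) := [set p | J `<=` spec_set p].

Definition zariski_open (U : set (spec R)) : Prop := exists J, U = ~` zeros J.

Fact zariski_openT : zariski_open setT.
Proof.
exists setT; apply/seteqP; split=> // p _ /= Rp.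
by have [_ + _] := spec_prime p; apply; exact: Rp.
Qed.

Fact zariski_openI : setI_closed zariski_open.
Proof.
move=> _ _ [J ->] [J' ->].
exists [set z | exists x y, [/\ J x, J' y & z = x * y]].
apply/seteqP; split=> p /=; have [[_ _ pM] _ pP] := spec_prime p.
  move=> [/existsNP[x /not_implyP[Jx px]] /existsNP[y /not_implyP[Jy py]]] JJ.
  by have [|/px|/py] // := pP x y; apply: JJ; exists x, y.
move=> JJ; split=> Jp; apply: JJ => z [x [y [Jx Jy ->]]]; last exact/pM/Jp.
by rewrite mulrC; exact/pM/Jp.
Qed.

Fact zariski_open_bigU (I : Type) (U : I -> set (spec R)) :
  (forall i, zariski_open (U i)) -> zariski_open (\bigcup_i U i).
Proof.
move=> /choice[J UJ]; exists (\bigcup_i J i); apply/seteqP; split=> p.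
  move=> [i _]; rewrite UJ /= => nJ Jp; apply: nJ => x Jx.
  by apply: Jp; exists i.
move=> /existsNP[x /not_implyP[[i _ Jx] px]]; exists i => //.
by rewrite UJ => /(_ _ Jx).
Qed.

HB.instance Definition _ := isOpenTopological.Build (spec R)
  zariski_openT zariski_openI zariski_open_bigU.

End Zariski.

Section Irreducible.
Variable X : topologicalType.

Definition irreducible (Z : set X) : Prop :=
  Z !=set0 /\ forall F G : set X, closed F -> closed G ->
    Z `<=` F `|` G -> Z `<=` F \/ Z `<=` G.

Definition irreducible_component (Y Z : set X) : Prop :=
  [/\ irreducible Z, Z `<=` Y &
      forall Z', irreducible Z' -> Z' `<=` Y -> Z `<=` Z' -> Z' = Z].

Definition generic_point (Z : set X) (x : X) : Prop := closure [set x] = Z.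

End Irreducible.

Section ZeroPrime.
Variable R : idomainType.

Fact prime_ideal0 : prime_ideal [set 0 : R].
Proof.
split; first split=> //= [x y -> ->|a x ->]; rewrite ?addr0 ?mulr0 //.
  by move/eqP; rewrite oner_eq0.
by move=> x y /= /eqP; rewrite mulf_eq0 => /orP[] /eqP; [left|right].
Qed.

Definition spec0 : spec R := Spec prime_ideal0.

End ZeroPrime.

Section Localization.
Variables (R : idomainType) (p : spec R).

Definition in_loc (x : {fraction R}) : bool :=
  `[< exists a s : R, ~ spec_set p s /\ x = to_frac R a / to_frac R s >].

Fact loc_neq0 (s : R) : ~ spec_set p s -> to_frac R s != 0.
Proof.
move=> ps; rewrite tofrac_eq0; apply/eqP => s0; apply: ps; rewrite s0.
by have [[]] := spec_prime p.
Qed.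

Fact loc_mul (s t : R) : ~ spec_set p s -> ~ spec_set p t -> ~ spec_set p (s * t).
Proof. by move=> ps pt; have [_ _ pP] := spec_prime p => /pP[]. Qed.

Fact in_loc_subring : subring_closed in_loc.
Proof.
have p1 : ~ spec_set p 1 by have [] := spec_prime p.
split.
- by apply/asboolP; exists 1, 1; split; rewrite // rmorph1 divr1.
- move=> _ _ /asboolP[a [s [ps ->]]] /asboolP[b [t [pt ->]]]; apply/asboolP.
  exists (a * t - b * s), (s * t); split; first exact: loc_mul.
  by rewrite -mulNr addf_div ?loc_neq0 // mulNr rmorphB !rmorphM.
- move=> _ _ /asboolP[a [s [ps ->]]] /asboolP[b [t [pt ->]]]; apply/asboolP.
  exists (a * b), (s * t); split; first exact: loc_mul.
  by rewrite !rmorphM /= mulf_div.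
Qed.

HB.instance Definition _ := GRing.isSubringClosed.Build _ in_loc in_loc_subring.

Definition localization : Type := {x | in_loc x}.
HB.instance Definition _ := SubChoice.on localization.
HB.instance Definition _ := [SubChoice_isSubComNzRing of localization by <:].

Fact to_loc_subproof (r : R) : in_loc (to_frac R r).
Proof.
apply/asboolP; exists r, 1; rewrite rmorph1 divr1; split=> //.
by have [] := spec_prime p.
Qed.

Definition to_loc_fun (r : R) : localization := Sub (to_frac R r) (to_loc_subproof r).

Fact to_loc_zmod : zmod_morphism to_loc_fun.
Proof. by move=> x y; apply: val_inj; rewrite /= rmorphB. Qed.
Fact to_loc_monoid : monoid_morphism to_loc_fun.
Proof. by split=> [|x y]; apply: val_inj; rewrite /= ?rmorph1 ?rmorphM. Qed.
HB.instance Definition _ := GRing.isZmodMorphism.Build R localization to_loc_fun to_loc_zmod.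
HB.instance Definition _ :=
  GRing.isMonoidMorphism.Build R localization to_loc_fun to_loc_monoid.

Definition to_loc : {rmorphism R -> localization} := to_loc_fun.

End Localization.

Section Partitions.
Variable T : Type.
Implicit Types (I C : set T) (P : set (set T)).

Definition is_partition I P : Prop :=
  [/\ forall C, P C -> C !=set0, trivIset P id & \bigcup_(C in P) C = I].

Definition coarser P' P : Prop :=
  forall C, P' C -> exists2 D, D `<=` P & C = \bigcup_(E in D) E.

Definition strictly_coarser P' P : Prop := coarser P' P /\ P' <> P.

Definition linked (F : set (set (set T))) (i j : T) : Prop :=
  exists P C, [/\ F P, P C, C i & C j].

(* The classes of the equivalence relation on [I] generated by lying in a common
   member of some partition of the family. *)
Definition partition_meet I (F : set (set (set T))) : set (set T) :=
  [set C | exists2 i, I i & C = [set j | clos_refl_trans T (linked F) i j]].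

Lemma partition_meetP I (F : set (set (set T))) :
  (forall P, F P -> is_partition I P) ->
  [/\ is_partition I (partition_meet I F),
      forall P, F P -> coarser (partition_meet I F) P &
      forall Q, is_partition I Q -> (forall P, F P -> coarser Q P) ->
        coarser Q (partition_meet I F)].
Proof.
move=> FI.
have linkI i j : clos_refl_trans T (linked F) i j -> I i -> I j.
  elim=> {i j} // [i j [P [C [FP PC _ Cj]]] _|i j k _ IH1 _ IH2 /IH1 /IH2 //].
  by have [_ _ <-] := FI _ FP; exists C.
have link_sym i j : clos_refl_trans T (linked F) i j ->
    clos_refl_trans T (linked F) j i.
  elim=> {i j} [i j [P [C [FP PC Ci Cj]]]|i|i j k _ ji _ kj].
  - by apply: rt_step; exists P, C.
  - exact: rt_refl.
  - exact: rt_trans kj ji.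
split.
- split.
  + by move=> _ [i _ ->]; exists i; exact: rt_refl.
  + move=> _ _ [i _ ->] [j _ ->] [k /= [ik jk]].
    apply/seteqP; split=> l /=.
      by apply: rt_trans; apply: rt_trans jk _; exact: link_sym.
    by apply: rt_trans; apply: rt_trans ik _; exact: link_sym.
  + apply/seteqP; split=> [j [_ [i Ii ->]] /linkI|i Ii]; first exact.
    exists [set j | clos_refl_trans T (linked F) i j]; last exact: rt_refl.
    by exists i.
- move=> P FP _ [i Ii ->].
  have [_ _ PI] := FI _ FP.
  exists [set E | P E /\ E `<=` [set j | clos_refl_trans T (linked F) i j]].
    by move=> E [].
  apply/seteqP; split=> [j ij|j [E [_ Ei] /Ei] //].
  have: I j by exact: linkI ij Ii.
  rewrite -PI => -[E PE Ej]; exists E => //; split=> // k Ek /=.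
  by apply: rt_trans ij _; apply: rt_step; exists P, E.
- move=> Q [_ _ QI] QF C QC.
  have Clinked i j : clos_refl_trans T (linked F) i j -> C i -> C j.
    elim=> {i j} // [i j [P [E [FP PE Ei Ej]]] Ci|i j k _ IH1 _ IH2 /IH1 /IH2 //].
    have [D DP CD] := QF _ FP _ QC.
    move: Ci; rewrite CD => -[E' DE' E'i]; exists E => //.
    have [_ Ptriv _] := FI _ FP.
    by have <- : E' = E; first by apply: Ptriv => //; [exact: DP | exists i].
  exists [set E | partition_meet I F E /\ E `<=` C]; first by move=> E [].
  apply/seteqP; split=> [i Ci|i [E [_ EC] /EC] //].
  exists [set j | clos_refl_trans T (linked F) i j]; last exact: rt_refl.
  split=> [|j /Clinked]; last exact.
  by exists i => //; rewrite -QI; exists C.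
Qed.

End Partitions.

Section BlockPartition.
Variables (R : idomainType) (A : algebra R).

Definition gen_fiber : algebra {fraction R} := base_change (to_frac R) A.

Definition loc_alg (p : spec R) : algebra (localization p) :=
  base_change (to_loc p) A.

(* The canonical map R_p (x) A -> K (x) A. *)
Definition loc_to_gen (p : spec R) : loc_alg p -> gen_fiber :=
  tlift (fun (x : restr (to_loc p) (localization p)^o) (a : alg_mod A) =>
    bc_pure (to_frac R) (val (x : localization p)) (a : A^o)).

Lemma loc_to_gen_pure (p : spec R) (x : localization p) (a : A) :
  loc_to_gen (bc_pure (to_loc p) x (a : A^o)) = bc_pure (to_frac R) (val x) (a : A^o).
Proof.
rewrite /loc_to_gen tlift_pure //; split=> [y z b|y b c|r y b].
- by rewrite raddfD bc_pureDl.
- by rewrite bc_pureDr.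
- exact: (bc_pureZ (to_frac R) r (val (y : localization p)) (b : A^o)).
Qed.

(* The index set I is the set of block idempotents c_i of A^K itself. *)
Definition Bl (p : spec R) : set (set gen_fiber) :=
  [set I' | I' `<=` @block_idempotent gen_fiber /\
     exists2 e, @block_idempotent (loc_alg p) e &
       loc_to_gen e = \sum_(c \in I') c].

Definition BlEx : set (spec R) := [set p | strictly_coarser (Bl p) (Bl (spec0 R))].

Definition At : set (set (spec R)) := [set Z | irreducible_component BlEx Z].

End BlockPartition.

Arguments Bl {R} A p _.
Arguments BlEx {R} A _.
Arguments At {R} A _.

(* Main.v *)
(* Let Q = A^K. For each p the central idempotents of Q lying in A_p form a
   Boolean algebra B(p) whose atoms are the blocks of A_p, and Bl(p) records the
   supports of these atoms. The meet of partitions corresponds to the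
   intersection of Boolean algebras, so the claim is that an idempotent c of Q
   lies in A_p as soon as it lies in A_z for the generic points z of all
   components of BlEx through p.

   Suppose that c = a/s is not in A_p. Among the annihilators of multiples of a
   in A/sA that are contained in p there is a prime q, and c is not in A_q. As A
   is flat, q is also an annihilator in R/sR, and as R is normal, q has height
   one. Now V(q) is contained in BlEx, which lies in V(d) for a common
   denominator d of the blocks of Q; hence V(q) is a component of BlEx through
   p, at whose generic point q the idempotent c is not defined. *)

From HB Require Import structures.
From Stdlib Require Import Relation_Operators.
Require Import Defs.
From mathcomp Require Import all_boot all_algebra generic_quotient.
From mathcomp Require Import boolp classical_sets fsbigop.
From mathcomp Require Import topology_structure.

Set Implicit Arguments.
Unset Strict Implicit.
Unset Printing Implicit Defensive.

Import GRing.Theory.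

Local Open Scope quotient_scope.
Local Open Scope classical_set_scope.
Local Open Scope ring_scope.

(** * Modules over commutative rings *)

Definition linear_pack (R : pzRingType) (U V : lmodType R) (f : U -> V)
    (f_lin : linear f) : {linear U -> V} :=
  HB.pack_for {linear U -> V} f (GRing.isLinear.Build R U V _ f f_lin).

Lemma ideal_generators (R : comPzRingType) (J : set R) :
  noetherian R -> is_ideal J -> exists n (g : 'I_n -> R), (forall i, J (g i)) /\
    forall x, J x -> exists c : 'I_n -> R, x = \sum_i c i * g i.
Proof.
move=> R_noeth /R_noeth[n [g Jg]]; exists n, g; rewrite Jg; split=> // i.
exists (fun j => (j == i)%:R).
by rewrite (bigD1 i) //= eqxx mul1r big1 ?addr0 // => j /negPf ->; rewrite mul0r.
Qed.

(** * Quotients of modules by submodules *)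

Section QuotientModule.
Variables (R : pzRingType) (V : lmodType R) (U : set V) (sU : submodule U).

Let U0 : U 0. Proof. by case: sU. Qed.
Let UD x y : U x -> U y -> U (x + y). Proof. by case: sU => _ + _; exact. Qed.
Let UZ a x : U x -> U (a *: x). Proof. by case: sU => _ _; exact. Qed.
Let UN x : U x -> U (- x). Proof. by move=> /(UZ (- 1)); rewrite scaleN1r. Qed.

Definition quot_rel (x y : V) : bool := `[< U (x - y) >].

Fact quot_rel_refl : reflexive quot_rel.
Proof. by move=> x; apply/asboolP; rewrite subrr. Qed.
Fact quot_rel_sym : symmetric quot_rel.
Proof. by move=> x y; apply/asboolP/asboolP => /UN; rewrite opprB. Qed.
Fact quot_rel_trans : transitive quot_rel.
Proof.
move=> y x z /asboolP xy /asboolP yz; apply/asboolP.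
by rewrite -(subrKA y); exact: UD.
Qed.

Canonical quot_equiv := EquivRel quot_rel quot_rel_refl quot_rel_sym quot_rel_trans.

Definition quot_mod : Type := {eq_quot quot_equiv}.
HB.instance Definition _ := Choice.on quot_mod.
HB.instance Definition _ := EqQuotient.on quot_mod.

Definition quot_pi (x : V) : quot_mod := \pi_quot_mod x.

Lemma quot_piP x y : quot_pi x = quot_pi y <-> U (x - y).
Proof. by split=> [/eqmodP/asboolP //|Uxy]; apply/eqmodP/asboolP. Qed.

Lemma quot_pi_repr (x : quot_mod) : quot_pi (repr x) = x.
Proof. exact: reprK. Qed.

Lemma repr_quot_pi x : U (repr (quot_pi x) - x).
Proof. by apply/quot_piP; rewrite quot_pi_repr. Qed.

Definition quot_add (x y : quot_mod) : quot_mod := quot_pi (repr x + repr y).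
Definition quot_opp (x : quot_mod) : quot_mod := quot_pi (- repr x).
Definition quot_scale a (x : quot_mod) : quot_mod := quot_pi (a *: repr x).

Lemma quot_add_pi x y : quot_add (quot_pi x) (quot_pi y) = quot_pi (x + y).
Proof.
by apply/quot_piP; rewrite opprD addrACA; apply: UD; exact: repr_quot_pi.
Qed.
Lemma quot_opp_pi x : quot_opp (quot_pi x) = quot_pi (- x).
Proof. by apply/quot_piP; rewrite -opprD; apply: UN; exact: repr_quot_pi. Qed.
Lemma quot_scale_pi a x : quot_scale a (quot_pi x) = quot_pi (a *: x).
Proof. by apply/quot_piP; rewrite -scalerBr; apply: UZ; exact: repr_quot_pi. Qed.

Lemma quot_surj (P : quot_mod -> Prop) : (forall x, P (quot_pi x)) -> forall x, P x.
Proof. by move=> Px x; rewrite -(quot_pi_repr x). Qed.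

Fact quot_addA : associative quot_add.
Proof.
elim/quot_surj=> x; elim/quot_surj=> y; elim/quot_surj=> z.
by rewrite !quot_add_pi addrA.
Qed.
Fact quot_addC : commutative quot_add.
Proof. by elim/quot_surj=> x; elim/quot_surj=> y; rewrite !quot_add_pi addrC. Qed.
Fact quot_add0 : left_id (quot_pi 0) quot_add.
Proof. by elim/quot_surj=> x; rewrite quot_add_pi add0r. Qed.
Fact quot_addN : left_inverse (quot_pi 0) quot_opp quot_add.
Proof. by elim/quot_surj=> x; rewrite quot_opp_pi quot_add_pi addNr. Qed.

HB.instance Definition _ :=
  GRing.isZmodule.Build quot_mod quot_addA quot_addC quot_add0 quot_addN.

Fact quot_scaleA a b x : quot_scale a (quot_scale b x) = quot_scale (a * b) x.
Proof. by elim/quot_surj: x => x; rewrite !quot_scale_pi scalerA. Qed.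
Fact quot_scale1 : left_id 1 quot_scale.
Proof. by elim/quot_surj=> x; rewrite quot_scale_pi scale1r. Qed.
Fact quot_scaleDr : right_distributive quot_scale +%R.
Proof.
move=> a; elim/quot_surj=> x; elim/quot_surj=> y.
by rewrite [quot_pi x + _]quot_add_pi !quot_scale_pi scalerDr -quot_add_pi.
Qed.
Fact quot_scaleDl x : {morph quot_scale^~ x : a b / a + b}.
Proof.
move=> a b; elim/quot_surj: x => x.
by rewrite !quot_scale_pi scalerDl -quot_add_pi.
Qed.

HB.instance Definition _ := GRing.Zmodule_isLmodule.Build R quot_mod
  quot_scaleA quot_scale1 quot_scaleDr quot_scaleDl.

Fact quot_pi_linear : linear quot_pi.
Proof. by move=> a x y; rewrite -quot_add_pi -quot_scale_pi. Qed.
HB.instance Definition _ := GRing.isLinear.Build R V quot_mod _ quot_pi quot_pi_linear.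

Lemma quot_pi_eq0 x : quot_pi x = 0 <-> U x.
Proof. by rewrite -(linear0 quot_pi) quot_piP subr0. Qed.

Section Lift.
Variables (W : lmodType R) (f : {linear V -> W}).
Hypothesis fU : forall x, U x -> f x = 0.

(** Evaluation at a chosen representative; by [quot_lift_pi] the choice is irrelevant once [f]
    vanishes on [U]. *)
Definition quot_lift (x : quot_mod) : W := f (repr x).

Lemma quot_lift_pi x : quot_lift (quot_pi x) = f x.
Proof. by apply/eqP; rewrite -subr_eq0 -linearB fU //; exact: repr_quot_pi. Qed.

Fact quot_lift_linear : linear quot_lift.
Proof.
move=> a; elim/quot_surj=> x; elim/quot_surj=> y.
by rewrite -linearP !quot_lift_pi linearP.
Qed.
End Lift.
End QuotientModule.

(** * Colon ideals and flatness *)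

Section ColonFlat.
Variables (R : comNzRingType) (M : lmodType R).
Hypothesis M_flat : flat M.

(** The submodule N M. A sequence of pairs indexes the sums, so that addition is concatenation. *)
Definition ideal_span (N : set R) : set M := [set x | exists2 t : seq (R * M),
  {in t, forall p, N p.1} & x = \sum_(p <- t) p.1 *: p.2].

Lemma ideal_span_submodule (N : set R) : is_ideal N -> submodule (ideal_span N).
Proof.
move=> [N0 ND NM]; split.
- by exists [::]; rewrite ?big_nil.
- move=> _ _ [t Nt ->] [u Nu ->]; exists (t ++ u); last by rewrite big_cat.
  by move=> p; rewrite mem_cat => /orP[/Nt|/Nu].
- move=> a _ [t Nt ->]; exists [seq (a * p.1, p.2) | p <- t].
    by move=> _ /mapP[p /Nt Np ->]; exact: NM.
  by rewrite big_map scaler_sumr; apply: eq_bigr => p _; rewrite scalerA.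
Qed.

(** The submodule s V: [scaled s (x *: a)] says that x annihilates a modulo s. *)
Definition scaled (s : R) (V : lmodType R) : set V := [set v | exists w, v = s *: w].

Lemma scaled_submodule s V : submodule (@scaled s V).
Proof.
split; first by exists 0; rewrite scaler0.
- by move=> _ _ [v ->] [w ->]; exists (v + w); rewrite scalerDr.
- by move=> a _ [v ->]; exists (a *: v); rewrite !scalerA mulrC.
Qed.

Definition colon (s : R) n (r : 'I_n -> R) : set R :=
  [set b | forall i, exists c, r i * b = s * c].

Lemma colon_ideal s n (r : 'I_n -> R) : is_ideal (colon s r).
Proof.
split=> [i|x y rx ry i|a x rx i]; first by exists 0; rewrite !mulr0.
- have [[c rc] [d rd]] := (rx i, ry i).
  by exists (c + d); rewrite !mulrDr rc rd.
- by have [c rc] := rx i; exists (a * c); rewrite !(mulrCA _ a) rc.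
Qed.

(* R/N embeds in (R/s)^n by 1 |-> (r_i), where N = (s : r); tensoring with M,
   the element a is sent to 0, hence a lies in N M. *)
Lemma flat_colon (s : R) n (r : 'I_n -> R) (a : M) :
  (forall i, scaled s (r i *: a)) -> ideal_span (colon s r) a.
Proof.
move=> sa.
have N_ideal := colon_ideal s r.
have N_sub : submodule (colon s r : set (R^o : lmodType R)) by [].
pose T : lmodType R := quot_mod (scaled_submodule s 'rV[R]_n).
pose rv : 'rV[R]_n := \row_i r i.
pose f (b : R^o) : T := quot_pi _ (b *: rv).
have f_lin : linear f.
  by move=> c x y; rewrite /f -linearP scalerA -scalerDl.
pose fL : {linear R^o -> T} := linear_pack f_lin.
have f0 b : f b = 0 <-> colon s r b.
  rewrite quot_pi_eq0; split=> [[w bw] i|rb].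
    by exists (w 0 i); have /rowP/(_ i) := bw; rewrite !mxE mulrC.
  have /choice[c bc] := rb; exists (\row_i c i).
  by apply/rowP => i; rewrite !mxE mulrC.
(* By [f0] the kernel of [f] is N, so the induced map on R/N is injective. *)
pose g := quot_lift (sU := N_sub) fL.
have fN b : colon s r b -> fL b = 0 by move/f0.
have liftE (b : R^o) : g (quot_pi N_sub b) = f b by exact: (@quot_lift_pi _ _ _ N_sub _ fL fN).
have g_lin : linear g by exact: (@quot_lift_linear _ _ _ N_sub _ fL fN).
pose gL : {linear quot_mod N_sub -> T} := linear_pack g_lin.
have g_inj : injective gL.
  apply: raddf_inj; elim/quot_surj=> b; rewrite /= liftE => /f0 Nb.
  exact/quot_pi_eq0.
pose one : quot_mod N_sub := quot_pi N_sub (1 : R^o).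
have zero_pure (P Q : lmodType R) (x : Q) : pure (0 : P) x = 0.
  by rewrite -(scale0r (0 : P)) -scale_pure scale0r.
have bal (P Q : lmodType R) (h : {linear P -> Q}) :
    balanced (fun (x : P) (m : M) => pure (h x) m).
  split=> [x y m|x m m'|c x m]; rewrite ?linearD ?pureDl ?pureDr //.
  by rewrite linearZ_LR pureZ.
have g1 : tensor_mapl gL (pure one a) = 0.
  rewrite /tensor_mapl tlift_pure; last exact: bal.
  rewrite /= liftE /f scale1r.
  have -> : rv = \sum_i r i *: delta_mx 0 i.
    by rewrite [LHS]row_sum_delta; apply: eq_bigr => i _; rewrite mxE.
  rewrite linear_sum.
  have pure_sum (I : finType) (F : I -> T) : pure (\sum_i F i) a = \sum_i pure (F i) a.
    by elim/big_rec2: _ => [|i x y _ <-]; rewrite ?zero_pure ?pureDl.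
  (* Moving r_i to the right factor gives r_i a = s m; moving s back to the left kills the unit
     vector in [T]. *)
  rewrite pure_sum big1 // => i _; rewrite linearZ /= pureZ.
  have [m ->] := sa i; rewrite -pureZ -linearZ /=.
  have -> : quot_pi (scaled_submodule s 'rV[R]_n) (s *: delta_mx 0 i) = 0.
    by apply/quot_pi_eq0; exists (delta_mx 0 i).
  exact: zero_pure.
have pure0 : pure one a = 0.
  apply: (M_flat g_inj); rewrite g1 /tensor_mapl tlift0 //; exact: bal.
(* Multiplication induces a map from the tensor product of R/N and M to M/NM, which sends
   [pure one a] to the class of a. *)
pose NM := quot_mod (ideal_span_submodule N_ideal).
pose h (x : quot_mod N_sub) (m : M) : NM := quot_pi _ ((repr x : R) *: m).
have h_pi x m : h (quot_pi _ x) m = quot_pi _ ((x : R) *: m).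
  apply/quot_piP; rewrite -scalerBl.
  exists [:: (repr (quot_pi N_sub x) - x, m)]; last by rewrite big_seq1.
  by move=> p; rewrite inE => /eqP ->; exact: (repr_quot_pi N_sub x).
have bal_h : balanced h.
  split=> [|x m m'|c].
  - elim/quot_surj=> x; elim/quot_surj=> y m.
    by rewrite -raddfD !h_pi scalerDl raddfD.
  - by rewrite /h scalerDr raddfD.
  - elim/quot_surj=> x m; rewrite -linearZ !h_pi /= scalerA.
    by rewrite -[c *: x]/(c * (x : R)) mulrC.
have : tlift h (pure one a) = 0 by rewrite pure0 tlift0.
by rewrite tlift_pure // h_pi scale1r => /quot_pi_eq0.
Qed.

(* Since the prime q is the annihilator of a modulo s, writing a = sum b_j m_j
   with b_j in (s : q) gives the inclusion of the intersection of the (s : b_j)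
   in q. *)
Lemma flat_annihilator (s : R) (q : set R) (a : M) :
  noetherian R -> prime_ideal q -> (forall x, q x <-> scaled s (x *: a)) ->
  exists b, forall x, q x <-> exists c, x * b = s * c.
Proof.
move=> R_noeth [q_ideal q1 q_prime] qa.
have [n [r [qr q_gen]]] := ideal_generators R_noeth q_ideal.
have [t Nt a_t] : ideal_span (colon s r) a by apply: flat_colon => i; exact/qa.
(* Every b in (s : q) gives q inside (s : b); what remains is to find such a b with (s : b) inside
   q. *)
have qN b : colon s r b -> forall x, q x -> exists c, x * b = s * c.
  move=> /choice[d rb] x /q_gen[c ->].
  exists (\sum_i c i * d i); rewrite mulr_sumr mulr_suml; apply: eq_bigr => i _.
  by rewrite -mulrA rb mulrCA.
suff [b [Nb qb]] : exists b, colon s r b /\ forall x, (exists c, x * b = s * c) -> q x.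
  by exists b => x; split; [exact: qN | exact: qb].
apply: contrapT => no_b; apply: (q1).
have {}no_b b : colon s r b -> exists x, ~ q x /\ exists c, x * b = s * c.
  move=> Nb; apply: contrapT => no_x; apply: no_b; exists b; split=> // x xb.
  by apply: contrapT => qx; apply: no_x; exists x.
(* Each coefficient is multiplied into s R by some element outside q; the product x of these
   elements is outside q, yet it kills a modulo s. *)
suff [x qx sx] : exists2 x, ~ q x & forall p, p \in t -> exists c, x * p.1 = s * c.
  exfalso; apply/qx/qa; rewrite a_t scaler_sumr.
  have [_ sD _] := scaled_submodule s M.
  rewrite big_seq; elim/big_rec: _ => [|p y pt sy].
    by have [] := scaled_submodule s M.
  apply: sD => //; rewrite scalerA; have [c ->] := sx p pt.
  by exists (c *: p.2); rewrite scalerA.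
elim: {a_t} t Nt => [|p t IH] Nt; first by exists 1.
have [u tu|x qx sx] := IH; first by apply: Nt; rewrite inE tu orbT.
have [y [qy [c yp]]] := no_b p.1 (Nt p (mem_head _ _)).
exists (y * x); first by move=> /q_prime[/qy|/qx].
move=> u; rewrite inE => /predU1P[->|/sx[d xu]].
  by exists (x * c); rewrite mulrAC yp mulrC mulrCA.
by exists (y * d); rewrite -mulrA xu mulrCA.
Qed.
End ColonFlat.

(** * Primes of height one *)

(** The union of a chain in [F] is an ideal, and its finitely many generators lie in one member,
    which is then the whole union. [set0] joins the family because Zorn's lemma also asks about the
    empty chain. *)
Lemma noetherian_maximal (R : comNzRingType) (F : set (set R)) :
  noetherian R -> F !=set0 -> (forall J, F J -> is_ideal J) ->
  exists2 J, F J & forall J', F J' -> J `<=` J' -> J' `<=` J.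
Proof.
move=> R_noeth [J0 FJ0] F_ideal.
have [|J [[->|FJ] Jmax]] := @Zorn_bigcup R (fun J => J = set0 \/ F J).
- move=> G GF G_tot; have [[J [GJ FJ]]|noF] := pselect (exists J, G J /\ F J); last first.
    left; apply/seteqP; split=> // x [J GJ Jx].
    by have [J0'|FJ] := GF _ GJ; [rewrite J0' in Jx | case: noF; exists J].
  right; set U := \bigcup_(X in G) X.
  have U_ideal : is_ideal U.
    split=> [|x y [X GX Xx] [Y GY Yy]|a x [X GX Xx]].
    - by exists J => //; have [] := F_ideal _ FJ.
    - wlog XY : X Y x y GX GY Xx Yy / X `<=` Y => [th|].
        have [XY|YX] := G_tot _ _ GX GY; first exact: (th X Y).
        by rewrite addrC; exact: (th Y X).
      exists Y => //; have [Y0|FY] := GF _ GY; first by rewrite Y0 in Yy.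
      by have [_ YD _] := F_ideal _ FY; apply: YD => //; exact: XY.
    - exists X => //; have [X0|FX] := GF _ GX; first by rewrite X0 in Xx.
      by have [_ _ XM] := F_ideal _ FX; exact: XM.
  have [n [g [Ugi U_gen]]] := ideal_generators R_noeth U_ideal.
  suff [X [GX FX Xg]] : exists X, [/\ G X, F X & forall i, X (g i)].
    suff -> : U = X by [].
    apply/seteqP; split=> [x|x Xx]; last by exists X.
    move=> /U_gen[c ->]; have [X0 XD XM] := F_ideal _ FX.
    by elim/big_ind: _ => // i _; exact: XM.
  suff [X [GX FX Xg]] : exists X, [/\ G X, F X & forall i, i \in enum 'I_n -> X (g i)].
    by exists X; split=> // i; apply: Xg; rewrite mem_enum.
  elim: (enum 'I_n) => [|i t [X [GX FX Xt]]]; first by exists J.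
  have [Y GY Yi] := Ugi i.
  have [XY|YX] := G_tot _ _ GX GY.
    exists Y; split=> // [|j]; last by rewrite inE => /predU1P[->|/Xt /XY].
    by have [Y0|//] := GF _ GY; rewrite Y0 in Yi.
  by exists X; split=> // j; rewrite inE => /predU1P[->|/Xt //]; exact: YX.
- exfalso; apply: (Jmax J0); last by right.
  by have [J00 _ _] := F_ideal _ FJ0; split=> // /(_ _ J00).
- exists J => // J' FJ' JJ'; apply: contrapT => nJ'.
  by apply: (Jmax J'); [split | right].
Qed.

(* Among the annihilators of multiples of a in V/U that are contained in p, a
   maximal one is prime. *)
Lemma associated_prime (R : comNzRingType) (V : lmodType R) (U : set V)
    (a : V) (p : set R) :
  noetherian R -> submodule U -> prime_ideal p -> (forall x, U (x *: a) -> p x) ->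
  exists r q, [/\ prime_ideal q, q `<=` p & forall x, q x <-> U (x *: (r *: a))].
Proof.
move=> R_noeth [U0 UD UZ] [p_ideal p1 p_prime] pa.
pose ann r : set R := [set x | U (x *: (r *: a))].
have ann_ideal r : is_ideal (ann r).
  split=> [|x y ax ay|b x ax]; rewrite /ann /= ?scale0r ?scalerDl //.
    exact: UD.
  by rewrite -scalerA; exact: UZ.
pose F : set (set R) := [set J | exists2 r, J = ann r & J `<=` p].
have [||_ [r -> rp] rmax] := @noetherian_maximal R F R_noeth.
- by exists (ann 1); exists 1 => // x; rewrite /ann /= scale1r => /pa.
- by move=> _ [r -> _].
(* Passing from r a to t r a does not enlarge the annihilator as long as the new one stays inside
   p. *)
have {}rmax t x : (forall y, U (y *: (t *: (r *: a))) -> p y) ->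
    U (x *: (t *: (r *: a))) -> U (x *: (r *: a)).
  move=> tp; have tr y : ann (t * r) y = U (y *: (t *: (r *: a))).
    by rewrite /ann /= -(scalerA t).
  rewrite -tr; apply: rmax => [|y ry].
    by exists (t * r) => // y; rewrite tr => /tp.
  by rewrite tr (scalerA y) (mulrC y) -scalerA; exact: UZ.
exists r, (ann r); split=> //; split=> // [/rp //|x y].
rewrite /ann /= => xy.
have [xp|] := pselect (forall z, U (z *: (x *: (r *: a))) -> p z).
  by right; apply: (rmax x y xp); rewrite (scalerA y) mulrC.
(* Some u outside p kills x r a. As p is prime, the annihilator of u r a stays in p, so by
   maximality x kills r a. *)
move=> /existsNP[u /not_implyP[ux pu]]; left; apply: (rmax u) => [v uv|].
  have : p (v * u) by apply: rp; rewrite /ann /= -scalerA.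
  by case/p_prime.
by rewrite (scalerA x) mulrC -scalerA.
Qed.

(** The determinant trick: y acts on generators of J by a matrix over R with the generators as a
    nonzero eigenvector, so y is a root of the monic characteristic polynomial and hence
    integral. *)
Lemma normal_stable_ideal (R : idomainType) (J : set R) (y : {fraction R}) :
  noetherian R -> normal_domain R -> is_ideal J -> (exists2 x, J x & x != 0) ->
  (forall x, J x -> exists2 z, J z & to_frac R x * y = to_frac R z) ->
  exists r, y = to_frac R r.
Proof.
move=> R_noeth R_normal J_ideal [x Jx x0] yJ; apply: R_normal.
have [n [g [Jgi J_gen]]] := ideal_generators R_noeth J_ideal.
have /choice[c yg] i : exists c : 'I_n -> R,
    to_frac R (g i) * y = to_frac R (\sum_j c j * g j).
  by have [z /J_gen[c ->] ->] := yJ _ (Jgi i); exists c.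
(* Transposed, since eigenvectors are row vectors. *)
pose M : 'M[R]_n := \matrix_(i, j) c j i.
exists (char_poly M); first exact: char_poly_monic.
rewrite map_char_poly -eigenvalue_root_char; apply/eigenvalueP.
exists (\row_i to_frac R (g i)).
  apply/rowP => i; rewrite !mxE mulrC yg rmorph_sum; apply: eq_bigr => j _.
  by rewrite !mxE mulrC -rmorphM.
apply: contraNneq x0 => /rowP g0; have [d ->] := J_gen x Jx.
rewrite big1 // => i _; have /eqP := g0 i; rewrite !mxE tofrac_eq0 => /eqP ->.
by rewrite mulr0.
Qed.

(* Let y = b/s. As y is not in R, it does not map q' to itself, so w = t y is
   outside q' for some t in q'; then x w = t (x y) is in q' for every x in q. *)
Lemma normal_colon_height1 (R : idomainType) (s b : R) (q q' : set R) :
  noetherian R -> normal_domain R -> s != 0 -> prime_ideal q -> prime_ideal q' ->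
  (forall x, q x <-> exists c, x * b = s * c) ->
  q' `<=` q -> (exists2 x, q' x & x != 0) -> q `<=` q'.
Proof.
move=> R_noeth R_normal s0 [_ q1 _] [q'_ideal _ q'_prime] q_colon q'q q'0 x qx.
have s0F : to_frac R s != 0 by rewrite tofrac_eq0.
pose y := to_frac R b / to_frac R s.
have yE z c : z * b = s * c -> to_frac R z * y = to_frac R c.
  by move=> zb; rewrite /y mulrA -rmorphM zb rmorphM mulrC mulKf.
(* If y were in R, then 1 would lie in (s : b) = q. *)
apply: contrapT => q'x; apply: q1; apply/q_colon.
have [|c yc] := @normal_stable_ideal R q' y R_noeth R_normal q'_ideal q'0; last first.
  exists c; rewrite mul1r; apply/eqP.
  by rewrite -tofrac_eq rmorphM /= -yc mulrC mulfVK.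
move=> t q't; have [w tw] : exists c, t * b = s * c by apply/q_colon/q'q.
exists w; last exact: yE.
have [v xv] : exists c, x * b = s * c by apply/q_colon.
have [|//] : q' x \/ q' w; last by [].
apply: q'_prime; suff -> : x * w = v * t by have [_ _ ] := q'_ideal; apply.
apply: (mulfI s0); rewrite mulrCA -tw mulrA mulrA -xv -!mulrA; congr (_ * _).
exact: mulrC.
Qed.

(** * Irreducible subsets of the spectrum *)

Section Spec.
Variable R : comPzRingType.
Implicit Types (p q : spec R).

Lemma zeros_closed (J : set R) : closed (@zeros R J).
Proof. by rewrite -[zeros J]setCK; apply: open_closedC; exists J. Qed.

Lemma closed_zeros (F : set (spec R)) : closed F -> exists J, F = zeros J.
Proof. by move=> /closed_openC[J FJ]; exists J; rewrite -[F]setCK FJ setCK. Qed.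

Lemma closure_spec1 q : closure [set q] = zeros (spec_set q).
Proof.
rewrite closureE; apply/seteqP; split.
  by apply: smallest_sub; [exact: zeros_closed | move=> _ ->].
move=> p qp F [/closed_zeros[J ->] Jq]; apply: subset_trans qp.
exact: (Jq q).
Qed.

(* The intersection of the points of an irreducible set is the prime ideal of
   its generic point. *)
Lemma irreducible_prime (Z : set (spec R)) : irreducible Z ->
  prime_ideal (\bigcap_(p in Z) spec_set p).
Proof.
move=> [[p0 Zp0] Z_irr]; split.
- split=> [p _|x y Zx Zy p Zp|a x Zx p Zp]; have [[p_0 pD pM] _ _] := spec_prime p => //.
    by apply: pD; [exact: Zx | exact: Zy].
  by apply: pM; exact: Zx.
- by move=> /(_ p0 Zp0); have [] := spec_prime p0.
- move=> x y Zxy.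
  have [|||Zx|Zy] := Z_irr (zeros [set x]) (zeros [set y]);
    do ?exact: zeros_closed.
  + move=> p Zp; have [_ _ /(_ x y (Zxy p Zp))[px|py]] := spec_prime p.
      by left=> _ ->.
    by right=> _ ->.
  + by left=> p /Zx; apply.
  + by right=> p /Zy; apply.
Qed.

(* The prime ideal of an irreducible subset of Y containing q contains d and is
   contained in q, hence is equal to q. *)
Lemma height1_component (Y : set (spec R)) q (d : R) :
  d <> 0 -> Y `<=` zeros [set d] -> zeros (spec_set q) `<=` Y ->
  (forall z : set R, prime_ideal z -> (exists2 x, z x & x <> 0) ->
    z `<=` spec_set q -> spec_set q `<=` z) ->
  irreducible_component Y (closure [set q]).
Proof.
move=> d0 Yd qY q_min; rewrite closure_spec1; split=> //.
- split=> [|F G]; first by exists q.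
  move=> /closed_zeros[J ->] /closed_zeros[J' ->] /(_ q (fun x => id)).
  by case=> Jq; [left|right] => p qp; apply: subset_trans qp.
- move=> Z Z_irr ZY qZ; apply/seteqP; split=> // p Zp.
  apply: subset_trans (q_min _ (irreducible_prime Z_irr) _ _) _.
  + by exists d => // p' /ZY /Yd; apply.
  + by move=> x Zx; apply: Zx; apply: qZ.
  + by move=> x; apply.
Qed.

End Spec.

(** * Boolean algebras of central idempotents *)

Section IdempotentAlgebra.
Variable Q : pzRingType.
Implicit Types (e f c : Q) (B : set Q) (s t : seq Q).

(** A Boolean algebra with the product as meet and 1 - e as complement; 0 and sums of orthogonal
    elements follow. *)
Definition idempotent_algebra B : Prop :=
  [/\ B `<=` @central_idempotent Q, B 1,
      forall e f, B e -> B f -> B (e * f) & forall e, B e -> B (1 - e)].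

(** The minimal nonzero elements for the order in which f lies below e when e f = f. *)
Definition atom B : set Q :=
  [set e | [/\ B e, e <> 0 & forall f, B f -> e * f = 0 \/ e * f = e]].

Definition orthogonal_seq s : Prop :=
  uniq s /\ {in s &, forall e f, e != f -> e * f = 0}.

Lemma central_idempotent_algebra : idempotent_algebra (@central_idempotent Q).
Proof.
split=> // [|e f [ee eC] [ff fC]|e [ee eC]].
- by split=> [|x]; rewrite ?mul1r ?mulr1.
- split=> [|x]; last by rewrite -mulrA fC mulrA eC mulrA.
  by rewrite mulrA -(mulrA e) fC mulrA ee -mulrA ff.
- split=> [|x]; last by rewrite mulrBl mulrBr mulr1 mul1r eC.
  by rewrite mulrBr mulr1 mulrBl mul1r ee subrr subr0.
Qed.

(** A decomposition e = e1 + e2 yields the test element f = e1; conversely f decomposes e as e f + e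
    (1 - f). *)
Lemma atom_central_idempotent : atom (@central_idempotent Q) = @block_idempotent Q.
Proof.
have [_ _ ciM ciN] := central_idempotent_algebra.
apply/seteqP; split=> e [ci_e e0 e_min]; split=> //.
- move=> e1 e2 ci1 ci2 e12 eE; have [[e11 e1C] [_ e2C]] := (ci1, ci2).
  have e_e1 : e * e1 = e1 by rewrite eE mulrDl e11 e2C e12 addr0.
  have := e_min e1 ci1; rewrite e_e1 => -[->|e1e]; first by left.
  by right; apply: (addrI e1); rewrite addr0 -eE e1e.
- move=> f ci_f; have [[ee eC] [ff fC]] := (ci_e, ci_f).
  have [||||->|ef0] := e_min (e * f) (e * (1 - f)).
  + exact: ciM.
  + by apply: ciM => //; exact: ciN.
  + by rewrite -(fC e) -mulrA (mulrA e e) ee fC -mulrA mulrBl mul1r ff subrr mulr0.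
  + by rewrite mulrBr mulr1 addrC subrK.
  + by left.
  + by right; apply/esym/eqP; rewrite -subr_eq0 -{1}[e]mulr1 -mulrBr ef0.
Qed.

Section Algebra.
Variable B : set Q.
Hypothesis B_alg : idempotent_algebra B.

Lemma idempotent_algebraD e f : B e -> B f -> e * f = 0 -> B (e + f).
Proof.
have [_ _ BM BN] := B_alg => Be Bf ef; suff <- : 1 - (1 - e) * (1 - f) = e + f.
  by apply/BN/BM; exact: BN.
by rewrite mulrBr mulr1 mulrBl mul1r ef subr0 opprB opprB addrC -addrA
  subrK addrC.
Qed.

Lemma idempotent_algebra0 : B 0.
Proof. by have [_ B1 _ BN] := B_alg; rewrite -(subrr 1); exact: BN. Qed.

Lemma idempotent_algebra_sum s (P : pred Q) :
  orthogonal_seq s -> {in s, forall e, B e} -> B (\sum_(e <- s | P e) e).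
Proof.
elim: s => [|e s IH] [s_uniq s_orth] sB.
  by rewrite big_nil; exact: idempotent_algebra0.
have /andP[es s_uniq'] := s_uniq.
have Bs : B (\sum_(e <- s | P e) e).
  apply: IH => [|f fs]; last by apply: sB; rewrite inE fs orbT.
  split=> // f g fs gs; apply: s_orth; rewrite inE ?fs ?gs orbT //.
rewrite big_cons; case: ifP => // _; apply: idempotent_algebraD => //.
  by apply: sB; exact: mem_head.
rewrite mulr_sumr big_seq_cond big1 // => f /andP[fs _].
apply: s_orth; rewrite ?mem_head // ?inE ?fs ?orbT //.
by apply: contraNneq es => ->.
Qed.

(* An orthogonal sequence of maximal size with sum 1 consists of atoms, as an
   element e that is not an atom could be replaced by e f and e (1 - f). *)
Lemma sum_atoms n :
  (forall s, {in s, forall e, @central_idempotent Q e /\ e != 0} ->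
    orthogonal_seq s -> (size s <= n)%N) ->
  exists s, [/\ {in s, forall e, atom B e}, orthogonal_seq s & \sum_(e <- s) e = 1].
Proof.
move=> bound; have [B_ci B1 BM BN] := B_alg.
pose dec s := [/\ {in s, forall e, B e /\ e != 0}, orthogonal_seq s & \sum_(e <- s) e = 1].
pose P k := `[< exists2 s, dec s & size s = k >].
have P_ex : exists k, P k.
  (* Entries have to be nonzero, so the zero ring is decomposed by the empty sequence. *)
  have [Q1|Q1] := eqVneq (1 : Q) 0.
    by exists 0; apply/asboolP; exists [::] => //; split; rewrite ?big_nil.
  exists 1; apply/asboolP; exists [:: 1] => //; split; rewrite ?big_seq1 //.
    by move=> e; rewrite inE => /eqP ->.
  by split=> // e f; rewrite !inE => /eqP -> /eqP ->; rewrite eqxx.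
have P_bound k : P k -> (k <= n)%N.
  move=> /asboolP[s [Bs s_orth _] <-]; apply: bound => // e /Bs[Be e0].
  by split=> //; exact: B_ci.
have [k /asboolP[s [sB [s_uniq s_orth] s1] sk] k_max] := ex_maxnP P_ex P_bound.
exists s; split=> // e es; have [Be e0] := sB e es; split=> //; first exact/eqP.
move=> f Bf; apply: contrapT => /not_orP[/eqP ef0 /eqP efe].
have [[ee eC] [ff fC]] := (B_ci e Be, B_ci f Bf).
pose t := rem e s.
have st : perm_eq s (e :: t) by exact: perm_to_rem.
pose x := e * f; pose y := e * (1 - f).
have Bx : B x by exact: BM.
have By : B y by apply/BM => //; exact: BN.
have [[xx xC] [yy yC]] := (B_ci x Bx, B_ci y By).
have xe : x * e = x by rewrite xC mulrA ee.
have ye : y * e = y by rewrite yC mulrA ee.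
have xyE : x + y = e by rewrite -mulrDr addrC subrK mulr1.
have xy0 : x * y = 0 by apply: (addrI x); rewrite -{1}xx -mulrDr xyE xe addr0.
have y_neq0 : y != 0 by rewrite /y mulrBr mulr1 subr_eq0 eq_sym.
have ts g : g \in t -> g \in s by exact: mem_rem.
have te g : g \in t -> e * g = 0.
  move=> gt; apply: (s_orth _ _ es (ts _ gt)).
  by apply: contraTneq gt => <-; rewrite mem_rem_uniqF.
(* Nonzero elements below e are not in t, as e kills t. *)
have ef_t h : h * e = h -> h != 0 -> h \notin t.
  by move=> he h0; apply: contra h0 => /te; rewrite eC he => ->.
have zt z g : z * e = z -> g \in t -> z * g = 0.
  by move=> <- /te eg; rewrite -mulrA eg mulr0.
have : (k.+1 <= k)%N.
  apply: k_max; apply/asboolP; exists [:: x, y & t]; last first.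
    by rewrite /= -sk (perm_size st).
  split; last first.
  - by rewrite !big_cons addrA xyE -s1 (perm_big _ st) big_cons.
  - split=> [|g h].
      rewrite /= inE negb_or (ef_t _ xe ef0) (ef_t _ ye y_neq0) rem_uniq // !andbT.
      by apply: contraNneq ef0 => xy; rewrite -/x -xx {2}xy xy0.
    rewrite !inE => /predU1P[->|/predU1P[->|gt]] /predU1P[->|/predU1P[->|ht]];
      rewrite ?eqxx // => gh.
    + exact: zt xe ht.
    + by rewrite yC.
    + exact: zt ye ht.
    + by rewrite -xC; exact: zt xe gt.
    + by rewrite -yC; exact: zt ye gt.
    + by apply: s_orth => //; exact: ts.
  - by move=> g; rewrite !inE => /predU1P[->|/predU1P[->|gt]] //; exact: sB (ts g gt).
by rewrite ltnn.
Qed.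
End Algebra.

(** The index set I' of e as a sum of blocks; [sum_supp] and [supp_sum] make central idempotents and
    sets of blocks correspond. *)
Definition supp e : set Q := [set c | block_idempotent c /\ e * c = c].

Definition atom_partition B : set (set Q) := [set supp e | e in atom B].

Section Blocks.
Variable n : nat.
Hypothesis bound : forall s, {in s, forall e, @central_idempotent Q e /\ e != 0} ->
  orthogonal_seq s -> (size s <= n)%N.

(** Atoms are equal or orthogonal, so a block outside a decomposition of 1 into atoms would be
    killed by 1. *)
Lemma block_seq : exists s, [/\ [set` s] = @block_idempotent Q, orthogonal_seq s &
  \sum_(e <- s) e = 1].
Proof.
have [s [s_atom s_orth s1]] := sum_atoms central_idempotent_algebra bound.
exists s; split=> //; rewrite -atom_central_idempotent.
apply/seteqP; split=> [e /s_atom //|c [ci_c c0 c_min]].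
apply: contrapT => cs; apply: c0; rewrite -[c]mulr1 -s1 mulr_sumr.
rewrite big_seq big1 // => e es; have [ci_e _ e_min] := s_atom e es.
have [//|ce] := c_min e ci_e; have [//|ec] := e_min c ci_c; last first.
  by case: cs; rewrite -ce; have [_ ->] := ci_c; rewrite ec.
by have [_ ->] := ci_c.
Qed.

Lemma atom_cover B c : idempotent_algebra B -> block_idempotent c ->
  exists2 e, atom B e & supp e c.
Proof.
move=> B_alg c_block; have [s [s_atom s_orth s1]] := sum_atoms B_alg bound.
have [B_ci _ _ _] := B_alg.
have := c_block; rewrite -{1}atom_central_idempotent => -[ci_c c0 c_min].
apply: contrapT => no_e; apply: c0; rewrite -[c]mulr1 -s1 mulr_sumr.
rewrite big_seq big1 // => e /s_atom e_atom; have [/B_ci ci_e _ _] := e_atom.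
have [//|ce] := c_min e ci_e; case: no_e; exists e => //; split=> //.
by have [_ ->] := ci_e.
Qed.

Lemma sum_blocksE s C : uniq s -> C `<=` [set` s] ->
  \sum_(c \in C) c = \sum_(c <- s | c \in C) c.
Proof.
move=> s_uniq Cs; rewrite -{1}(setIidr Cs) fsbig_mkcondr [RHS]big_mkcond.
by rewrite [RHS]fsbig_seq.
Qed.

Lemma sum_supp e : central_idempotent e -> \sum_(c \in supp e) c = e.
Proof.
move=> ci_e; have [s [s_block [s_uniq s_orth] s1]] := block_seq.
rewrite (sum_blocksE s_uniq); last by move=> c []; rewrite s_block.
rewrite -[RHS]mulr1 -s1 mulr_sumr big_mkcond; apply: eq_big_seq => c cs.
have c_block : block_idempotent c by rewrite -s_block.
case: ifPn => [|]; first by rewrite inE => -[_ ->].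
rewrite notin_setE => ec; have := c_block.
rewrite -atom_central_idempotent => -[ci_c _ /(_ e ci_e)].
have [_ ->] := ci_c; case=> // ece; case: ec; split=> //.
Qed.

Lemma sum_blocks_central C : C `<=` @block_idempotent Q ->
  central_idempotent (\sum_(c \in C) c).
Proof.
have [s [s_block s_orth _]] := block_seq; rewrite -s_block => Cs.
rewrite (sum_blocksE (proj1 s_orth)) //.
apply: (idempotent_algebra_sum central_idempotent_algebra) => // e es.
have : block_idempotent e by rewrite -s_block.
by case.
Qed.

Lemma supp_sum C : C `<=` @block_idempotent Q -> supp (\sum_(c \in C) c) = C.
Proof.
move=> C_block; have [s [s_block [s_uniq s_orth] s1]] := block_seq.
have sumM c : c \in s -> (\sum_(c \in C) c) * c = if c \in C then c else 0.
  move=> cs; rewrite (sum_blocksE s_uniq) ?s_block // mulr_suml big_mkcond.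
  rewrite (bigD1_seq c) //= big_seq_cond big1 => [|d /andP[ds dc]].
    rewrite addr0; case: ifP => // _; have : block_idempotent c by rewrite -s_block.
    by case=> -[].
  by case: ifP => // _; rewrite s_orth.
apply/seteqP; split=> [c [c_block]|c Cc].
  rewrite sumM; last by move: c_block; rewrite -s_block.
  case: ifPn => [|_ /esym c0]; first by rewrite inE.
  by case: c_block.
split; first exact: C_block.
rewrite sumM; last by have := C_block c Cc; rewrite -s_block.
by rewrite mem_set.
Qed.

Lemma mul_supp e f : central_idempotent e -> supp e `<=` supp f -> f * e = e.
Proof.
move=> ci_e ef; have [s [s_block [s_uniq s_orth] s1]] := block_seq.
rewrite -(sum_supp ci_e) (sum_blocksE s_uniq); last by move=> c []; rewrite s_block.
rewrite mulr_sumr big_seq_cond [RHS]big_seq_cond; apply: eq_bigr => c.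
by move=> /andP[_ /set_mem /ef[]].
Qed.

Lemma supp_neq0 e : central_idempotent e -> e <> 0 -> supp e !=set0.
Proof.
move=> ci_e e0; apply/set0P/eqP => supp0; apply: e0.
by rewrite -(sum_supp ci_e) supp0 fsbig_set0.
Qed.

(** Either [f] kills the atom [e] or lies above it, and a common block rules out the first. *)
Lemma atom_supp_sub B e f : idempotent_algebra B -> atom B e -> B f ->
  supp e `&` supp f !=set0 -> supp e `<=` supp f.
Proof.
move=> [B_ci _ _ _] [Be e0 e_min] Bf [c [[[_ c0 _] ec] [_ fc]]] d [d_block ed].
split=> //; have [ef0|ef] := e_min f Bf.
  by case: c0; rewrite -ec -fc mulrA ef0 mul0r.
by rewrite -ed mulrA; have [_ ->] := B_ci f Bf; rewrite ef.
Qed.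

(* The sum h of a class of the meet lies in each B of the family: an atom f of B
   whose support meets the class has its whole support in it, so h is a sum of
   atoms of B. *)
Lemma atom_partition_meet B (G : set (set Q)) :
  idempotent_algebra B -> (forall B', G B' -> idempotent_algebra B') ->
  (forall e, B e <-> central_idempotent e /\ forall B', G B' -> B' e) ->
  atom_partition B = partition_meet (@block_idempotent Q) (atom_partition @` G).
Proof.
move=> B_alg G_alg BG; set F := atom_partition @` G.
pose cls i := [set j | clos_refl_trans Q (linked F) i j].
have [B_ci _ _ _] := B_alg.
have atom_cls e i : atom B e -> supp e i -> supp e = cls i.
  move=> e_atom ei; have [Be e0 e_min] := e_atom; have i_block := proj1 ei.
  (* Links stay inside [supp e]: e lies in every B' of the family, so an atom of B' sharing a block
     with e has its support inside that of e. *)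
  have ecls j k : clos_refl_trans Q (linked F) j k -> supp e j -> supp e k.
    elim=> {j k} // [j k [_ [_ [[B' GB' <-] [f f_atom <-] fj fk]]] ej|
      j k l _ IH1 _ IH2 /IH1 /IH2 //].
    have B'e : B' e by have [_ ] := (BG e).1 Be; apply.
    by apply: (atom_supp_sub (G_alg _ GB') f_atom B'e); first by exists j.
  apply/seteqP; split=> [|j /ecls]; last exact.
  have cls_block : cls i `<=` @block_idempotent Q by move=> j /ecls /(_ ei)[].
  (* For the other inclusion: once h is known to lie in [B], it shares the block i with the atom e
     and hence lies above e. *)
  pose h := \sum_(c \in cls i) c.
  have ci_h : central_idempotent h by exact: sum_blocks_central.
  have h_supp : supp h = cls i by exact: supp_sum.
  suff Bh : B h.
    rewrite -h_supp; apply: (atom_supp_sub B_alg e_atom Bh).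
    by exists i; split=> //; rewrite h_supp; exact: rt_refl.
  apply/BG; split=> // B' GB'; have B'_alg := G_alg _ GB'.
  have [s [s_atom s_orth s1]] := sum_atoms B'_alg bound.
  suff -> : h = \sum_(f <- s | h * f == f) f.
    by apply: (idempotent_algebra_sum B'_alg) => // f /s_atom[].
  rewrite -[LHS]mulr1 -s1 mulr_sumr [RHS]big_mkcond; apply: eq_big_seq => f fs.
  case: eqP => // hf; apply: contrapT => hf0; apply: hf.
  have f_atom := s_atom f fs; have [B'f _ _] := f_atom.
  have ci_f : central_idempotent f by have [B'_ci _ _ _] := B'_alg; exact: B'_ci.
  have [_ _ ciM _] := central_idempotent_algebra.
  have [c [c_block hfc]] := supp_neq0 (ciM _ _ ci_h ci_f) hf0.
  have [[hh hC] [ff fC]] := (ci_h, ci_f).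
  have hc : supp h c by split=> //; rewrite -hfc !mulrA hh.
  have fc : supp f c by split=> //; rewrite -hfc hC !mulrA ff.
  apply: mul_supp => // d fd; rewrite h_supp; rewrite h_supp in hc.
  apply: rt_trans hc _; apply: rt_step; exists (atom_partition B'), (supp f).
  by split=> //; [exists B' | exists f].
apply/seteqP; split=> [_ [e e_atom <-]|_ [i i_block ->]].
  have [Be e0 _] := e_atom.
  have [i ei] := supp_neq0 (B_ci e Be) e0.
  by exists i; [have [] := ei | exact: atom_cls].
have [e e_atom ei] := atom_cover B_alg i_block.
by exists e => //; exact: atom_cls.
Qed.
End Blocks.
End IdempotentAlgebra.

(** * Localizations inside the generic fibre *)

Lemma fraction_quotient (R : idomainType) (x : {fraction R}) :
  exists r s, s != 0 /\ x = to_frac R r / to_frac R s.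
Proof.
elim/quotW: x => x; exists (\n_x), (\d_x); split; first exact: denom_ratioP.
have dx : to_frac R \d_x != 0 by rewrite tofrac_eq0 denom_ratioP.
apply: (mulIf dx); rewrite mulfVK //.
have : FracField.mul (\pi x) (FracField.tofrac \d_x) = FracField.tofrac \n_x; last by [].
rewrite !piE; apply/eqmodP; rewrite /= FracField.equivfE /FracField.mulf.
by rewrite !numden_Ratio ?mulf_neq0 ?oner_eq0 ?denom_ratioP // !mulr1 mulrC.
Qed.

Lemma bc_pureM (R B : comPzRingType) (f : {rmorphism R -> B}) (A : algebra R)
    (b b' : B) (a a' : A) :
  (bc_pure f b (a : A^o) : base_change f A) * bc_pure f b' (a' : A^o) =
  bc_pure f (b * b') (a * a' : A^o).
Proof. exact: bc_act_pure. Qed.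

Section FlatFamily.
Variables (R : idomainType) (A : algebra R).
Implicit Types (p q : spec R).

Local Notation K := {fraction R}.
Local Notation Q := (gen_fiber A).
Local Notation M := (alg_mod A).

(** The fraction a/s in A^K. *)
Definition gen_frac (s : R) (a : A) : Q := bc_pure (to_frac R) (to_frac R s)^-1 (a : A^o).

Lemma gen_fracM (s t : R) (a : A) : s != 0 -> t != 0 ->
  gen_frac s a = gen_frac (s * t) (alg_map A t * a).
Proof.
move=> s0 t0; rewrite /gen_frac -[alg_map A t * a]/(alg_map A t *: (a : A^o)) -bc_pureZ.
by rewrite rmorphM invfM mulrCA mulfV ?mulr1 // tofrac_eq0.
Qed.

Lemma gen_fracD (s t : R) (a b : A) : s != 0 -> t != 0 ->
  gen_frac s a + gen_frac t b = gen_frac (s * t) (alg_map A t * a + alg_map A s * b).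
Proof.
move=> s0 t0; rewrite (gen_fracM a s0 t0) (gen_fracM b t0 s0) (mulrC t).
exact/esym/bc_pureDr.
Qed.

Lemma spec_neq0 p s : ~ spec_set p s -> s != 0.
Proof. by move=> ps; apply/eqP => s0; apply: ps; rewrite s0; have [[]] := spec_prime p. Qed.

Lemma loc_to_gen_balanced p :
  balanced (fun (x : restr (to_loc p) (localization p)^o) (a : M) =>
    bc_pure (to_frac R) (val (x : localization p)) (a : A^o)).
Proof.
split=> [y z b|y b c|r y b].
- by rewrite raddfD bc_pureDl.
- by rewrite bc_pureDr.
- exact: (bc_pureZ (to_frac R) r (val (y : localization p)) (b : A^o)).
Qed.

Lemma loc_to_genD p : {morph @loc_to_gen _ A p : x y / x + y}.
Proof. by apply: tliftD; exact: loc_to_gen_balanced. Qed.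

Lemma loc_to_gen0 p : @loc_to_gen _ A p 0 = 0.
Proof. by apply: tlift0; exact: loc_to_gen_balanced. Qed.

Lemma loc_to_gen1 p : @loc_to_gen _ A p 1 = 1.
Proof. exact: loc_to_gen_pure. Qed.

Lemma loc_to_genM p : {morph @loc_to_gen _ A p : x y / x * y}.
Proof.
pose phi : loc_alg A p -> Q := @loc_to_gen _ A p.
have phiD (x y : loc_alg A p) : phi (x + y) = phi x + phi y by exact: loc_to_genD.
suff phiM (x y : loc_alg A p) : phi (x * y) = phi x * phi y by [].
move: x; apply: tensor_eq => [x x'|x x'|b a].
- by rewrite -phiD -mulrDl.
- by rewrite phiD mulrDl.
move: y; apply: tensor_eq => [y y'|y y'|b' a'].
- by rewrite -phiD -mulrDr.
- by rewrite phiD mulrDr.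
pose pu (b : localization p) (a : A) : loc_alg A p := bc_pure (to_loc p) b (a : A^o).
have puE (c : localization p) (d : A) :
    phi (pu c d) = bc_pure (to_frac R) (val c) (d : A^o).
  exact: loc_to_gen_pure.
suff puM (c c' : localization p) (d d' : A) :
    phi (pu c d * pu c' d') = phi (pu c d) * phi (pu c' d') by exact: puM.
rewrite !puE [pu c d * _]bc_pureM puE; apply/esym; exact: bc_pureM.
Qed.

(** A_p as a subset of A^K, where localizations at different primes can be compared. *)
Definition gen_image p : set Q := range (@loc_to_gen _ A p).

Lemma gen_frac_image p s a : ~ spec_set p s -> gen_image p (gen_frac s a).
Proof.
move=> ps; have sP : in_loc p (to_frac R s)^-1.
  by apply/asboolP; exists 1, s; rewrite rmorph1 div1r.
exists (bc_pure (to_loc p) (Sub (to_frac R s)^-1 sP : localization p) (a : A^o)) => //.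
exact: loc_to_gen_pure.
Qed.

(** The pure tensor of r/s and a is the fraction (r a)/s, and the product of two denominators
    outside p is again outside p. *)
Lemma gen_imageP p c : gen_image p c <-> exists s a, ~ spec_set p s /\ c = gen_frac s a.
Proof.
split=> [[x _ <-]|[s [a [ps ->]]]]; last exact: gen_frac_image.
move: x; apply: tensor_ind.
- exists 1, 0; split; first by have [] := spec_prime p.
  rewrite loc_to_gen0; apply/esym/(addrI (gen_frac 1 0)).
  by rewrite addr0 /gen_frac -bc_pureDr addr0.
- move=> b a; have /asboolP[r [s [ps bE]]] := valP (b : localization p).
  exists s, (alg_map A r * a); split=> //.
  rewrite loc_to_gen_pure bE -[to_frac R r / _]/(to_frac R r * _).
  exact: (bc_pureZ (to_frac R) r _ (a : A^o)).
- move=> x y [s [a [ps xE]]] [t [b [pt yE]]].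
  exists (s * t), (alg_map A t * a + alg_map A s * b).
  split; first exact: loc_mul.
  apply: (etrans (loc_to_genD x y)); rewrite xE yE.
  by apply: gen_fracD; [exact: spec_neq0 ps | exact: spec_neq0 pt].
Qed.

Lemma gen_image_spec0 c : gen_image (spec0 R) c.
Proof.
apply/gen_imageP; move: c; apply: tensor_ind.
- by have /gen_imageP : gen_image (spec0 R) 0 by exists 0 => //; exact: loc_to_gen0.
- move=> b a; have [r [s [s0 ->]]] : exists r s, s != 0 /\ b = to_frac R r / to_frac R s :> K.
    by exact: fraction_quotient.
  exists s, (alg_map A r * a); split; first exact/eqP.
  exact: (bc_pureZ (to_frac R) r _ (a : A^o)).
- move=> x y [s [a [/eqP s0 ->]]] [t [b [/eqP t0 ->]]].
  exists (s * t), (alg_map A t * a + alg_map A s * b); rewrite gen_fracD //; split=> //.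
  by apply/eqP; rewrite mulf_eq0 negb_or s0.
Qed.

Lemma gen_image_sub p q : spec_set q `<=` spec_set p -> gen_image p `<=` gen_image q.
Proof.
by move=> qp c /gen_imageP[s [a [ps ->]]]; apply: gen_frac_image => /qp.
Qed.

Section Flat.
Hypothesis A_flat : flat M.

(** The map is [tensor_mapl] of the inclusion of R_p into K, so flatness applies directly. *)
Lemma loc_to_gen_inj p : injective (@loc_to_gen _ A p).
Proof.
pose v (x : restr (to_loc p) (localization p)^o) : restr (to_frac R) K^o :=
  val (x : localization p).
have v_lin : linear v by move=> r x y; rewrite /v rmorphD rmorphM.
pose vL := linear_pack v_lin.
have v_inj : injective vL by exact: val_inj.
exact: (A_flat v_inj).
Qed.

(** Multiplying by s t turns both sides into images of pure tensors over R. By flatness these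
    tensors agree already over R, and the multiplication map takes them to A. *)
Lemma gen_frac_inj (s t : R) (a b : A) : s != 0 -> t != 0 ->
  gen_frac s a = gen_frac t b -> alg_map A t * a = alg_map A s * b.
Proof.
move=> s0 t0 ab.
pose v (x : R^o) : restr (to_frac R) K^o := to_frac R x.
have v_lin : linear v by move=> r x y; rewrite /v rmorphD rmorphM.
pose vL := linear_pack v_lin.
have v_inj : injective vL by move=> x y /eqP; rewrite tofrac_eq => /eqP.
have bal : balanced (fun (x : R^o) (m : M) => pure (vL x) m).
  split=> [x y m|x m m'|c x m]; rewrite ?linearD ?pureDl ?pureDr //.
  by rewrite linearZ_LR pureZ.
have bal' : balanced (fun (x : R^o) (m : M) => (x : R) *: m).
  split=> [x y m|x m m'|c x m]; rewrite ?scalerDl ?scalerDr //.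
  by rewrite scalerA mulrC.
have eq_pure (x y : R) (m m' : M) : pure (vL x) m = pure (vL y) m' -> x *: m = y *: m'.
  move=> xy; have : pure (x : R^o) m = pure (y : R^o) m'.
    by apply: (A_flat v_inj); rewrite /tensor_mapl !tlift_pure.
  by move=> /(congr1 (tlift (fun (x : R^o) (m : M) => (x : R) *: m))); rewrite !tlift_pure.
apply: (eq_pure t s a b).
have := congr1 (fun z : Q => bc_map (to_frac R) A (to_frac R (s * t)) * z) ab.
rewrite !bc_pureM !mul1r (mulrC s) !rmorphM mulfK ?tofrac_eq0 //.
by rewrite [to_frac R t * _]mulrC mulfK ?tofrac_eq0.
Qed.

End Flat.
End FlatFamily.

(** * Block partitions *)

Section FlatBlocks.
Variables (R : idomainType) (A : algebra R).
Hypotheses (A_fg : finitely_generated (alg_mod A)) (A_flat : flat (alg_mod A)).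
Implicit Types (p q : spec R).

Local Notation K := {fraction R}.
Local Notation Q := (gen_fiber A).
Local Notation M := (alg_mod A).

(** Elements of A^K are fractions a/s, and a is expanded in generators of A. Scalars of K act
    through [bc_map]. *)
Lemma gen_fiber_span : exists n (v : 'I_n -> Q), forall x : Q,
  exists c : 'I_n -> K, x = \sum_i bc_map (to_frac R) A (c i) * v i.
Proof.
have [n [g g_gen]] := A_fg; pose v i : Q := bc_pure (to_frac R) 1 (g i : A^o).
exists n, v => x; have /gen_imageP[s [a [_ ->]]] := gen_image_spec0 x.
have [c ->] := g_gen a; exists (fun i => to_frac R (c i) / to_frac R s).
pose h (b : M) : Q := gen_frac s b.
have hD (b b' : M) : h (b + b') = h b + h b' by exact: bc_pureDr.
have h0 : h 0 = 0 by apply: (addrI (h 0)); rewrite -hD !addr0.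
rewrite -[LHS]/(h _) (big_morph h hD h0); apply: eq_bigr => i _.
apply: (etrans (esym (bc_pureZ (to_frac R) (c i) _ (g i : A^o)))).
by apply/esym; apply: (etrans (bc_pureM _ _ _ _ _)); rewrite mul1r mulr1.
Qed.

(* Orthogonal nonzero idempotents are linearly independent over K. *)
Lemma gen_fiber_bound : exists n, forall s : seq Q,
  {in s, forall e, @central_idempotent Q e /\ e != 0} -> orthogonal_seq s ->
  (size s <= n)%N.
Proof.
have [n [v v_span]] := gen_fiber_span.
exists n => s s_ci [s_uniq s_orth]; rewrite leqNgt; apply/negP => ns.
have /choice[c cE] (j : 'I_(size s)) : exists c : 'I_n -> K,
  s`_j = \sum_i bc_map (to_frac R) A (c i) * v i by exact: v_span.
(* With more rows than columns, [C] has a nonzero u in its left kernel, which is a linear relation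
   between the members of [s]. *)
pose C : 'M[K]_(size s, n) := \matrix_(j, i) c j i.
have : kermx C != 0.
  by rewrite kermx_eq0 -row_leq_rank -ltnNge (leq_ltn_trans (rank_leq_col C)).
case/rowV0Pn=> u /sub_kermxP uC /eqP u0; apply: u0.
apply/rowP => j; rewrite mxE; apply: contrapT => /eqP uj.
have sj : s`_j \in s by exact: mem_nth.
have [[ss _] /eqP] := s_ci _ sj; apply.
have us : \sum_k bc_map (to_frac R) A (u 0 k) * s`_k = 0 :> Q.
  under eq_bigr do rewrite cE mulr_sumr.
  rewrite exchange_big big1 // => i _.
  under eq_bigr do rewrite mulrA -rmorphM.
  rewrite -mulr_suml -rmorph_sum.
  have -> : \sum_k u 0 k * c k i = 0.
    by have /rowP/(_ i) := uC; rewrite !mxE => uCi; rewrite -[RHS]uCi;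
       apply: eq_bigr => k _; rewrite mxE.
  by rewrite rmorph0 mul0r.
(* Multiplying the relation by one member isolates its coefficient. *)
have : bc_map (to_frac R) A (u 0 j) * s`_j = 0 :> Q.
  have := congr1 (fun x : Q => x * s`_j) us.
  rewrite mul0r mulr_suml (bigD1 j) //= -mulrA ss big1 ?addr0 // => k kj.
  have kj0 : s`_k * s`_j = 0 by apply: s_orth; rewrite ?mem_nth ?nth_uniq.
  by rewrite -mulrA kj0 mulr0.
move=> /(congr1 (fun x : Q => bc_map (to_frac R) A (u 0 j)^-1 * x)).
by rewrite mulr0 mulrA -rmorphM mulVf // rmorph1 mul1r.
Qed.

Definition gen_idempotents p : set Q :=
  [set e | @central_idempotent Q e /\ gen_image p e].

Lemma gen_idempotents_algebra p : idempotent_algebra (gen_idempotents p).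
Proof.
pose phi : loc_alg A p -> Q := @loc_to_gen _ A p.
have phiD (x y : loc_alg A p) : phi (x + y) = phi x + phi y by exact: loc_to_genD.
have phiM (x y : loc_alg A p) : phi (x * y) = phi x * phi y by exact: loc_to_genM.
have phi1 : phi 1 = 1 by exact: loc_to_gen1.
have imN (x : loc_alg A p) : phi (1 - x) = 1 - phi x.
  by apply: (addIr (phi x)); rewrite -phiD !subrK.
have [_ ci1 ciM ciN] := central_idempotent_algebra Q.
split.
- by move=> e [].
- by split=> //; exists 1.
- move=> e f [ci_e [x _ xe]] [ci_f [y _ yf]]; split; first exact: ciM.
  by exists (x * y) => //; rewrite -xe -yf; exact: phiM.
- move=> e [ci_e [x _ xe]]; split; first exact: ciN.
  by exists (1 - x) => //; rewrite -xe; exact: imN.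
Qed.

(** Every element of A^K is a central scalar 1/s times the image of an element of A_p; the converse
    uses injectivity. *)
Lemma loc_to_gen_central p (e : loc_alg A p) :
  central_idempotent e <-> central_idempotent (loc_to_gen e : Q).
Proof.
pose phi : loc_alg A p -> Q := @loc_to_gen _ A p.
have phiM (x y : loc_alg A p) : phi (x * y) = phi x * phi y by exact: loc_to_genM.
have phi_inj : injective phi by exact: loc_to_gen_inj.
split=> -[ee eC]; split.
- by rewrite -[LHS]phiM ee.
- move=> x; have /gen_imageP[s [a [_ ->]]] := gen_image_spec0 x.
  pose sV : Q := bc_map (to_frac R) A (to_frac R s)^-1.
  pose ax := bc_pure (to_loc p) 1 (a : A^o) : loc_alg A p.
  have -> : gen_frac s a = sV * phi ax.
    rewrite [phi ax]loc_to_gen_pure; apply/esym.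
    by apply: (etrans (bc_pureM _ _ _ _ _)); rewrite mul1r mulr1.
  have sVC y : sV * y = y * sV by exact: bc_mapC.
  by rewrite -[loc_to_gen e]/(phi e) mulrA -sVC -mulrA -phiM eC phiM mulrA.
- by apply: phi_inj; rewrite phiM.
- by move=> x; apply: phi_inj; rewrite !phiM; exact: eC.
Qed.

Lemma loc_to_gen_block p (e : loc_alg A p) :
  block_idempotent e <-> atom (gen_idempotents p) (loc_to_gen e).
Proof.
pose phi : loc_alg A p -> Q := @loc_to_gen _ A p.
have phiM (x y : loc_alg A p) : phi (x * y) = phi x * phi y by exact: loc_to_genM.
have phi_inj : injective phi by exact: loc_to_gen_inj.
have phi0 : phi 0 = 0 by exact: loc_to_gen0.
rewrite -atom_central_idempotent; split=> -[ci_e e0 e_min]; split.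
- split; first exact/loc_to_gen_central.
  by exists e.
- by rewrite -[loc_to_gen e]/(phi e) -phi0 => /phi_inj.
- move=> f [ci_f [y _ yf]]; move: ci_f; rewrite -yf -loc_to_gen_central => ci_y.
  have [ey|ey] := e_min y ci_y; [left|right]; rewrite -[loc_to_gen e * _]phiM ey //.
- by have [] := ci_e; rewrite -loc_to_gen_central.
- by move=> ee; apply: e0; rewrite ee; exact: phi0.
- move=> f ci_f; have [|ef|ef] := e_min (phi f).
  + split; first exact/loc_to_gen_central.
    by exists f.
  + by left; apply: phi_inj; rewrite phiM phi0.
  + by right; apply: phi_inj; rewrite phiM.
Qed.

(** Blocks of A_p are the atoms of its algebra in A^K, and the only set of blocks with sum e is
    [supp e]. Localizations now enter only through their images. *)
Lemma BlE p : Bl A p = atom_partition (gen_idempotents p).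
Proof.
have [n bound] := gen_fiber_bound.
apply/seteqP; split=> [C [C_block [e e_block eC]]|_ [e e_atom <-]].
  exists (loc_to_gen e); first exact/loc_to_gen_block.
  by rewrite eC (supp_sum bound).
have [[ci_e [x _ xe]] _ _] := e_atom.
split; first by move=> c [].
by exists x; [apply/loc_to_gen_block; rewrite xe | rewrite xe (sum_supp bound)].
Qed.

(** Every central idempotent is a sum of blocks. *)
Lemma gen_idempotents_full p : (forall c : Q, block_idempotent c -> gen_image p c) ->
  gen_idempotents p = @central_idempotent Q.
Proof.
move=> block_im; have [n bound] := gen_fiber_bound.
apply/seteqP; split=> [e []//|e ci_e].
have [s [s_block s_orth _]] := block_seq bound.
rewrite -(sum_supp bound ci_e) (sum_blocksE (proj1 s_orth)); last first.
  by move=> c []; rewrite s_block.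
apply: (idempotent_algebra_sum (gen_idempotents_algebra p)) => // c cs.
have c_block : block_idempotent c by rewrite -s_block.
by split; [case: c_block | exact: block_im].
Qed.

Lemma Bl_spec0 : Bl A (spec0 R) = atom_partition (@central_idempotent Q).
Proof. by rewrite BlE gen_idempotents_full // => c _; exact: gen_image_spec0. Qed.

Lemma supp_block (c : Q) : block_idempotent c -> supp c = [set c].
Proof.
move=> c_block; apply/seteqP; split=> [d [d_block cd]|_ ->]; last first.
  by split=> //; case: c_block => -[].
move: c_block d_block; rewrite -atom_central_idempotent.
move=> [ci_c _ c_min] [ci_d d0 _]; have [cd0|cdc] := c_min d ci_d.
  by case: d0; rewrite -cd.
by rewrite /= -cd.
Qed.

Lemma Bl_spec0_set1 (c : Q) : block_idempotent c -> Bl A (spec0 R) [set c].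
Proof.
move=> c_block; rewrite Bl_spec0; exists c; last exact: supp_block.
by rewrite atom_central_idempotent.
Qed.

(** The partition at p is always coarser than the one into singletons. Equality would put every
    block in A_p, and with them every central idempotent, in particular e. *)
Lemma BlEx_of_not_image p (e : Q) :
  central_idempotent e -> ~ gen_image p e -> BlEx A p.
Proof.
move=> ci_e im_e; have [n bound] := gen_fiber_bound; split.
  rewrite BlE => _ [f _ <-]; exists [set [set c] | c in supp f].
    by move=> _ [c [c_block _] <-]; exact: Bl_spec0_set1.
  apply/seteqP; split=> [c fc|c [_ [d fd <-] ->] //].
  by exists [set c] => //; exists c.
move=> BlE0; apply: im_e; suff [] : gen_idempotents p e by [].
rewrite gen_idempotents_full // => c c_block.
have := Bl_spec0_set1 c_block; rewrite -BlE0 BlE => -[f [[ci_f f_im] _ _] fc].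
suff <- : f = c by [].
by rewrite -(sum_supp bound ci_f) fc fsbig_set1.
Qed.

(** Take for d a product of denominators of the blocks: where d is not in p, all blocks lie in A_p
    and the partition is the finest. *)
Lemma BlEx_sub_zeros : exists d : R, d <> 0 /\ BlEx A `<=` zeros [set d].
Proof.
have [n bound] := gen_fiber_bound; have [s [s_block _ _]] := block_seq bound.
suff [d [d0 ds]] : exists d : R, d <> 0 /\
    forall p, ~ spec_set p d -> forall c, c \in s -> gen_image p c.
  exists d; split=> // p [_ Blp] _ ->; apply: contrapT => pd; apply: Blp.
  rewrite Bl_spec0 BlE gen_idempotents_full // => c.
  by rewrite -s_block => /(ds p pd).
elim: {s_block} s => [|c s [d [d0 ds]]]; first by exists 1; split=> //; apply/eqP/oner_neq0.
have /gen_imageP[t [a [t0 cE]]] := gen_image_spec0 c.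
exists (t * d); split=> [/eqP|p ptd b].
  by rewrite mulf_eq0 => /orP[/eqP|/eqP].
have [_ _ pM] : is_ideal (spec_set p) by have [] := spec_prime p.
rewrite inE => /predU1P[->|]; last by apply: ds => pd; apply: ptd; exact: pM.
by rewrite cE; apply: gen_frac_image => pt; apply: ptd; rewrite mulrC; exact: pM.
Qed.

(* For c = a/s outside A_p, some multiple of a has as annihilator modulo s a
   prime ideal q contained in p; by flatness q = (s : b), so that q has height
   one by normality. *)
Lemma gen_image_height1 p (c : Q) :
  noetherian R -> normal_domain R -> ~ gen_image p c ->
  exists q, [/\ spec_set q `<=` spec_set p, ~ gen_image q c &
    forall z : set R, prime_ideal z -> (exists2 x, z x & x <> 0) ->
      z `<=` spec_set q -> spec_set q `<=` z].
Proof.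
move=> R_noeth R_normal pc; have /gen_imageP[s [a [/eqP s0 cE]]] := gen_image_spec0 c.
(* If t a = s m, then c = a/s = m/t. *)
have scaled_im q t : ~ spec_set q t -> scaled s ((t : R) *: (a : M)) -> gen_image q c.
  move=> qt [m tm]; apply/gen_imageP; exists t, m; split=> //.
  have t0 := spec_neq0 qt; rewrite cE (gen_fracM a s0 t0).
  rewrite (gen_fracM m t0 s0) mulrC; congr gen_frac; exact: tm.
have [r [q [q_prime qp qE]]] := associated_prime (a := a : M) R_noeth
  (scaled_submodule s M) (spec_prime p) (fun t ta => contrapT (fun pt => pc (scaled_im p t pt ta))).
exists (Spec q_prime); split=> //=.
  (* If c = b/t, then t a = s b, so t annihilates r a modulo s and lies in q. *)
  move=> /gen_imageP[t [b [/= qt]]]; rewrite cE.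
  move=> /(gen_frac_inj A_flat s0 (spec_neq0 (p := Spec q_prime) qt)) ta.
  have tab : t *: (a : M) = s *: (b : M) by exact: ta.
  apply/qt/qE; exists (r *: (b : M)).
  by rewrite (scalerA t) mulrC -(scalerA r) tab (scalerA r) mulrC -(scalerA s).
move=> z z_prime [x zx /eqP x0] zq.
have [b qb] := flat_annihilator A_flat R_noeth q_prime qE.
by apply: (normal_colon_height1 R_noeth R_normal s0 q_prime z_prime qb zq); exists x.
Qed.

End FlatBlocks.

Theorem theorem1p4 (R : idomainType) (A : algebra R)
    (R_noetherian : noetherian R) (R_normal : normal_domain R)
    (A_fg : finitely_generated (alg_mod A)) (A_flat : flat (alg_mod A))
    (AK_split : split_algebra (gen_fiber A)) (p : spec R) :
  Bl A p =
  partition_meet (@block_idempotent (gen_fiber A))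
    [set P | exists Z x, [/\ At A Z, Z p, generic_point Z x & P = Bl A x]].
Proof.
have [n bound] := gen_fiber_bound A_fg.
pose F := [set x | exists Z, [/\ At A Z, Z p & generic_point Z x]].
have -> : [set P | exists Z x, [/\ At A Z, Z p, generic_point Z x & P = Bl A x]] =
    (@atom_partition _) @` (@gen_idempotents R A @` F).
  apply/seteqP; split=> [_ [Z [x [ZAt Zp Zx ->]]]|_ [_ [x [Z [ZAt Zp Zx]] <-] <-]].
    by rewrite (BlE A_fg A_flat); exists (gen_idempotents x) => //; exists x => //; exists Z.
  by exists Z, x; split=> //; rewrite (BlE A_fg A_flat).
rewrite (BlE A_fg A_flat).
(* The meet of partitions becomes an intersection of Boolean algebras, so only membership of
   idempotents is left to compare. *)
apply: (atom_partition_meet bound (gen_idempotents_algebra A p)).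
  by move=> _ [x _ <-]; exact: gen_idempotents_algebra.
move=> e; split=> [[ci_e e_im]|[ci_e eF]].
  (* A generic point of a component through p is contained in p, so A_p lies in the localization
     there. *)
  split=> // _ [x [Z [_ Zp Zx]] <-]; split=> //; apply: gen_image_sub e_im.
  by move: Zp; rewrite -Zx closure_spec1.
split=> //; apply: contrapT => pe.
have [q [qp qe q_min]] := gen_image_height1 A_flat R_noetherian R_normal pe.
have [d [d0 BlEx_d]] := BlEx_sub_zeros A_fg A_flat.
have qF : F q.
  exists (closure [set q]); split=> //; last by rewrite closure_spec1.
  (* V(q) lies in [BlEx]: for q' containing q, the image of A_q' lies in that of A_q, which does not
     contain e. *)
  apply: (height1_component d0 BlEx_d _ q_min) => q' qq'.
  by apply: (BlEx_of_not_image A_fg A_flat ci_e) => /(gen_image_sub qq').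
by have [|_ /qe] := eF (gen_idempotents q); first by exists q.
Qed.
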